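(* Let $(\widetilde M,\mathcal P,\widetilde g)$ be a para-Kähler manifold and let $M=N_\top\times_f N_\perp$ be a $\mathcal P R$-warped product in $\widetilde M$, with second fundamental form $\sigma$. Suppose that $N_\perp$ is space-like and that $\nabla^\perp(\mathcal P N_\perp)\subseteq \mathcal P N_\perp$, i.e. $\nabla^\perp_U(\mathcal P Z)$ is a section of $\mathcal P\mathcal D^\perp$ for every vector field $U$ tangent to $M$ and every section $Z$ of $\mathcal D^\perp$. Then $$S_\sigma\le 2p\,\|\nabla\ln f\|_2+\|\sigma^{\mathcal D}_\nu\|_2,$$ where $p=\dim N_\perp$, $S_\sigma=\widetilde g(\sigma,\sigma)$, $\nabla \ln f$ is the gradient of $\ln f$ with respect to the induced metric $g$ of $M$, and $\|\sigma_\nu^{\mathcal D}\|_2=\widetilde g\big(\sigma_\nu(\mathcal D,\mathcal D),\sigma_\nu(\mathcal D,\mathcal D)\big)$, $\sigma_\nu$ being the $\nu$-component of $\sigma$.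
   Context: An almost para-Hermitian manifold is a manifold $\widetilde M$ with a $(1,1)$-tensor field $\mathcal P\neq\pm I$ and a pseudo-Riemannian metric $\widetilde g$ such that $\mathcal P^2=I$ and $\widetilde g(\mathcal P X,\mathcal P Y)=-\widetilde g(X,Y)$ for all vector fields $X,Y$. It is para-Kähler if $\widetilde\nabla\mathcal P=0$, where $\widetilde\nabla$ is the Levi-Civita connection of $\widetilde g$. For a vector $X$, $\|X\|_2=\widetilde g(X,X)$ (no square root; it may be negative). A pseudo-Riemannian submanifold is a submanifold on which $\widetilde g$ induces a non-degenerate metric $g$. It is invariant if $\mathcal P$ maps its tangent bundle to itself, and anti-invariant if $\mathcal P$ maps each tangent space into the normal space. A pseudo-Riemannian submanifold $M$ is a $\mathcal P R$-submanifold if $TM=\mathcal D\oplus\mathcal D^\perp$ with $\mathcal P\mathcal D=\mathcal D$ and $\mathcal P\mathcal D^\perp\subseteq T^\perp M$. For pseudo-Riemannian manifolds $(B,g_B)$, $(F,g_F)$ and a positive function $f$ on $B$, the warped product $B\times_f F$ is $B\times F$ with the metric $g_B+f^2 g_F$. A $\mathcal P R$-warped product is a $\mathcal P R$-submanifold that is a warped product $N_\top\times_f N_\perp$ of an invariant submanifold $N_\top$ and an anti-invariant submanifold $N_\perp$ of $\widetilde M$, with $f:N_\top\to\mathbb R_+$ non-constant. Here $\mathcal D$ (resp. $\mathcal D^\perp$) is the distribution tangent to the $N_\top$ (resp. $N_\perp$) factors. ''$N_\perp$ is space-like'' means that its metric is positive definite. $\sigma$ is defined by the Gauss formula $\widetilde\nabla_XY=\nabla_XY+\sigma(X,Y)$,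 and $\nabla^\perp$ is the normal connection. $\nu$ is the orthogonal complement of $\mathcal P\mathcal D^\perp$ in the normal bundle $T^\perp M$. The squared norms are taken with respect to (pseudo-)orthonormal frames with signs: if $e_1,\dots,e_n$ is a local orthonormal frame of $TM$ with $\epsilon_A=g(e_A,e_A)=\pm1$, then $\widetilde g(\sigma,\sigma)=\sum_{A,B}\epsilon_A\epsilon_B\,\widetilde g(\sigma(e_A,e_B),\sigma(e_A,e_B))$. If $e_1,\dots,e_{r}$ is an orthonormal frame of $\mathcal D$, then $\widetilde g(\sigma_\nu(\mathcal D,\mathcal D),\sigma_\nu(\mathcal D,\mathcal D))=\sum_{A,B\le r}\epsilon_A\epsilon_B\,\widetilde g(\sigma_\nu(e_A,e_B),\sigma_\nu(e_A,e_B))$. *)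

(* Defs.v *)
From HB Require Import structures.
From mathcomp Require Import all_boot all_order all_algebra.
From mathcomp Require Import all_classical all_reals all_analysis.
Set Implicit Arguments.
Unset Strict Implicit.
Unset Printing Implicit Defensive.
Import Order.TTheory GRing.Theory Num.Theory.
Import numFieldNormedType.Exports.
Local Open Scope classical_set_scope.
Local Open Scope ring_scope.

(** Row-vector convention throughout: a tangent vector is a row vector [v],
    an endomorphism or differential acts by [v *m A], and the inner product of
    [v] and [w] for the Gram matrix [g] is [v *m g *m w^T].  In particular
    [v *m jacobian f u] is the differential ['d f u v]. *)

(** ** Smoothness on a (typically open) subset of a normed space *)

Fixpoint Ck (R : realType) (V W : normedModType R) (k : nat) (A : set V)
    (f : V -> W) : Prop :=
  match k with
  | 0 => forall u, A u -> {for u, continuous f}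
  | k'.+1 => (forall u, A u -> differentiable f u) /\
             (forall v : V, Ck k' A (fun u => 'D_v f u))
  end.

Definition smooth_on (R : realType) (V W : normedModType R) (A : set V)
    (f : V -> W) : Prop :=
  forall k, Ck k A f.

(** ** Manifolds *)

(** [param i] is the inverse of the chart [chart i : dom i -> R^n]; the values
    of [chart i] off [dom i] and of [param i] off [coords i] are irrelevant. *)
Record atlas (R : realType) (n : nat) := Atlas {
  point :> topologicalType;
  idx : Type;
  dom : idx -> set point;
  chart : idx -> point -> 'rV[R]_n;
  param : idx -> 'rV[R]_n -> point }.
Arguments dom {R n a}.
Arguments chart {R n a}.
Arguments param {R n a}.

Definition coords (R : realType) (n : nat) (M : atlas R n) (i : idx M)
    : set 'rV[R]_n :=
  chart i @` dom i.

Definition transition (R : realType) (n : nat) (M : atlas R n) (i j : idx M)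
    (u : 'rV[R]_n) : 'rV[R]_n :=
  chart j (param i u).

Definition transition_dom (R : realType) (n : nat) (M : atlas R n)
    (i j : idx M) : set 'rV[R]_n :=
  chart i @` (dom i `&` dom j).

Record smooth_manifold (R : realType) (n : nat) (M : atlas R n) : Prop := {
  manifold_hausdorff : hausdorff_space M;
  manifold_countable : @second_countable M;
  dom_cover : forall x : M, exists i, dom i x;
  dom_open : forall i : idx M, open (dom i);
  coords_open : forall i : idx M, open (coords i);
  chartK : forall (i : idx M) x, dom i x -> param i (chart i x) = x;
  chart_continuous : forall (i : idx M) x,
    dom i x -> {for x, continuous (chart i)};
  param_continuous : forall (i : idx M) u,
    coords i u -> {for u, continuous (param i)};
  transition_smooth : forall i j : idx M,
    smooth_on (transition_dom i j) (transition i j) }.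

Definition prod_atlas (R : realType) (m n : nat) (M : atlas R m)
    (N : atlas R n) : atlas R (m + n) :=
  @Atlas R (m + n) (M * N)%type (idx M * idx N)%type
    (fun i => dom i.1 `*` dom i.2)
    (fun i x => row_mx (chart i.1 x.1) (chart i.2 x.2))
    (fun i u => (param i.1 (lsubmx u), param i.2 (rsubmx u))).

(** The expression of a map between manifolds in a pair of charts. *)
Definition overlap (R : realType) (m n : nat) (M : atlas R m) (N : atlas R n)
    (phi : M -> N) (i : idx M) (a : idx N) : set 'rV[R]_m :=
  chart i @` (dom i `&` phi @^-1` dom a).

Definition loc (R : realType) (m n : nat) (M : atlas R m) (N : atlas R n)
    (phi : M -> N) (i : idx M) (a : idx N) (u : 'rV[R]_m) : 'rV[R]_n :=
  chart a (phi (param i u)).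

Definition smooth_function (R : realType) (n : nat) (M : atlas R n)
    (f : M -> R) : Prop :=
  forall i : idx M, smooth_on (coords i) (f \o param i).

Definition smooth_map (R : realType) (m n : nat) (M : atlas R m)
    (N : atlas R n) (phi : M -> N) : Prop :=
  continuous phi /\ forall i a, smooth_on (overlap phi i a) (loc phi i a).

(** ** Tensor fields *)

(** A tensor field of rank 2 is given by its component matrices in the
    charts, as functions of the coordinates. *)
Definition tensor2 (R : realType) (n : nat) (M : atlas R n) : Type :=
  idx M -> 'rV[R]_n -> 'M[R]_n.

Definition inner (R : realType) (n : nat) (g : 'M[R]_n) (v w : 'rV[R]_n) : R :=
  (v *m g *m w^T) 0 0.

Record pseudo_riemannian_metric (R : realType) (n : nat) (M : atlas R n)
    (g : tensor2 M) : Prop := {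
  metric_smooth : forall i, smooth_on (coords i) (g i);
  metric_sym : forall i u, coords i u -> (g i u)^T = g i u;
  metric_nondeg : forall i u, coords i u -> g i u \in unitmx;
  metric_transition : forall i j u, transition_dom i j u ->
    g i u = jacobian (transition i j) u *m g j (transition i j u)
              *m (jacobian (transition i j) u)^T }.

Definition space_like (R : realType) (n : nat) (M : atlas R n)
    (g : tensor2 M) : Prop :=
  forall i u, coords i u -> forall v, v != 0 -> 0 < inner (g i u) v v.

Record smooth_endomorphism (R : realType) (n : nat) (M : atlas R n)
    (P : tensor2 M) : Prop := {
  endo_smooth : forall i, smooth_on (coords i) (P i);
  endo_transition : forall i j u, transition_dom i j u ->
    P i u *m jacobian (transition i j) u
    = jacobian (transition i j) u *m P j (transition i j u) }.

(** ** Levi-Civita connection in a chart *)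

Definition partial (R : realType) (n : nat) (k : 'I_n) (h : 'rV[R]_n -> R)
    (u : 'rV[R]_n) : R :=
  'D_(delta_mx 0 k) h u.

(** [christoffel g u k i j] is Gamma^k_ij of the Levi-Civita connection. *)
Definition christoffel (R : realType) (n : nat) (g : 'rV[R]_n -> 'M[R]_n)
    (u : 'rV[R]_n) (k i j : 'I_n) : R :=
  2^-1 * \sum_(l < n) invmx (g u) k l *
    (partial i (fun x => g x j l) u + partial j (fun x => g x i l) u
     - partial l (fun x => g x i j) u).

(** Covariant derivative, for the metric [G] of the target, of a vector field
    [V] along a map [phi], in the direction of the vector field [X] of the
    source. *)
Definition nabla_along (R : realType) (m n : nat) (G : 'rV[R]_n -> 'M[R]_n)
    (phi : 'rV[R]_m -> 'rV[R]_n) (X : 'rV[R]_m -> 'rV[R]_m)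
    (V : 'rV[R]_m -> 'rV[R]_n) (u : 'rV[R]_m) : 'rV[R]_n :=
  'D_(X u) V u +
  \row_(k < n) \sum_(i < n) \sum_(j < n)
    christoffel G (phi u) k i j * (X u *m jacobian phi u) 0 i * V u 0 j.

Definition nabla (R : realType) (n : nat) (g : 'rV[R]_n -> 'M[R]_n)
    (X Y : 'rV[R]_n -> 'rV[R]_n) (u : 'rV[R]_n) : 'rV[R]_n :=
  'D_(X u) Y u +
  \row_(k < n) \sum_(i < n) \sum_(j < n)
    christoffel g u k i j * X u 0 i * Y u 0 j.

Definition gradient (R : realType) (n : nat) (g : 'rV[R]_n -> 'M[R]_n)
    (h : 'rV[R]_n -> R) (u : 'rV[R]_n) : 'rV[R]_n :=
  (\row_(k < n) partial k h u) *m invmx (g u).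

(** ** Para-Kaehler manifolds *)

Record almost_para_hermitian (R : realType) (n : nat) (M : atlas R n)
    (g P : tensor2 M) : Prop := {
  aph_manifold : smooth_manifold M;
  aph_metric : pseudo_riemannian_metric g;
  aph_endo : smooth_endomorphism P;
  aph_neqI : ~ (forall i u, coords i u -> P i u = 1%:M);
  aph_neqNI : ~ (forall i u, coords i u -> P i u = - 1%:M);
  aph_square : forall i u, coords i u -> P i u *m P i u = 1%:M;
  aph_compat : forall i u, coords i u -> forall v w,
    inner (g i u) (v *m P i u) (w *m P i u) = - inner (g i u) v w }.

Record para_kaehler (R : realType) (n : nat) (M : atlas R n)
    (g P : tensor2 M) : Prop := {
  pk_aph : almost_para_hermitian g P;
  pk_parallel : forall (i : idx M) (A : set 'rV[R]_n)
      (X Y : 'rV[R]_n -> 'rV[R]_n),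
    open A -> A `<=` coords i -> smooth_on A X -> smooth_on A Y ->
    forall u, A u ->
      nabla (g i) X (fun x => Y x *m P i x) u
      = nabla (g i) X Y u *m P i u }.

(** ** Local geometry of a submanifold *)

(** Here [G] is the metric of the ambient manifold in a chart, and
    [phi] is the immersion in coordinates. *)

Definition push (R : realType) (m n : nat) (phi : 'rV[R]_m -> 'rV[R]_n)
    (X : 'rV[R]_m -> 'rV[R]_m) (u : 'rV[R]_m) : 'rV[R]_n :=
  X u *m jacobian phi u.

Definition pullback (R : realType) (m n : nat) (G : 'rV[R]_n -> 'M[R]_n)
    (phi : 'rV[R]_m -> 'rV[R]_n) (u : 'rV[R]_m) : 'M[R]_m :=
  jacobian phi u *m G (phi u) *m (jacobian phi u)^T.

Definition tangent_space (R : realType) (m n : nat)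
    (phi : 'rV[R]_m -> 'rV[R]_n) (u : 'rV[R]_m) : 'M[R]_n :=
  <<jacobian phi u>>%MS.

(** The vectors [v] with [v *m g *m w^T = 0] for all [w] in the row space of
    [A]. *)
Definition orthogonal_space (R : realType) (k n : nat) (g : 'M[R]_n)
    (A : 'M[R]_(k, n)) : 'M[R]_n :=
  kermx (g *m A^T).

Definition normal_space (R : realType) (m n : nat) (G : 'rV[R]_n -> 'M[R]_n)
    (phi : 'rV[R]_m -> 'rV[R]_n) (u : 'rV[R]_m) : 'M[R]_n :=
  orthogonal_space (G (phi u)) (tangent_space phi u).

(** Second fundamental form, by the Gauss formula. *)
Definition sff (R : realType) (m n : nat) (G : 'rV[R]_n -> 'M[R]_n)
    (phi : 'rV[R]_m -> 'rV[R]_n) (X Y : 'rV[R]_m -> 'rV[R]_m)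
    (u : 'rV[R]_m) : 'rV[R]_n :=
  nabla_along G phi X (push phi Y) u
  - push phi (nabla (pullback G phi) X Y) u.

Definition normal_connection (R : realType) (m n : nat)
    (G : 'rV[R]_n -> 'M[R]_n) (phi : 'rV[R]_m -> 'rV[R]_n)
    (X : 'rV[R]_m -> 'rV[R]_m) (xi : 'rV[R]_m -> 'rV[R]_n)
    (u : 'rV[R]_m) : 'rV[R]_n :=
  nabla_along G phi X xi u
    *m proj_mx (normal_space G phi u) (tangent_space phi u).

(** [e] is an orthonormal frame on [A] of the distribution [u |-> D u]. *)
Record orthonormal_frame (R : realType) (m k r : nat)
    (g : 'rV[R]_m -> 'M[R]_m) (A : set 'rV[R]_m) (D : 'rV[R]_m -> 'M[R]_(k, m))
    (e : 'I_r -> 'rV[R]_m -> 'rV[R]_m) : Prop := {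
  frame_smooth : forall s, smooth_on A (e s);
  frame_span : forall u, A u -> (\matrix_(s < r) e s u == D u)%MS;
  frame_orth : forall u, A u -> forall s t, s != t ->
    inner (g u) (e s u) (e t u) = 0;
  frame_unit : forall u, A u -> forall s,
    inner (g u) (e s u) (e s u) = 1 \/ inner (g u) (e s u) (e s u) = -1 }.

(** The signed sum over [s], [t] of
    eps_s eps_t G(beta(e_s, e_t), beta(e_s, e_t)), eps_s = g(e_s, e_s). *)
Definition signed_sqnorm (R : realType) (m n r : nat) (g : 'M[R]_m)
    (G : 'M[R]_n) (e : 'I_r -> 'rV[R]_m -> 'rV[R]_m)
    (beta : ('rV[R]_m -> 'rV[R]_m) -> ('rV[R]_m -> 'rV[R]_m) ->
            'rV[R]_m -> 'rV[R]_n) (u : 'rV[R]_m) : R :=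
  \sum_(s < r) \sum_(t < r)
    inner g (e s u) (e s u) * inner g (e t u) (e t u) *
    inner G (beta (e s) (e t) u) (beta (e s) (e t) u).

Record pseudo_riemannian_submanifold (R : realType) (m n : nat)
    (M : atlas R m) (N : atlas R n) (G : tensor2 N) (phi : M -> N) : Prop := {
  sub_smooth : smooth_map phi;
  sub_immersion : forall i a u, overlap phi i a u ->
    row_free (jacobian (loc phi i a) u);
  sub_nondeg : forall i a u, overlap phi i a u ->
    pullback (G a) (loc phi i a) u \in unitmx }.

(** ** PR-warped products *)

Definition warped_metric (R : realType) (b p : nat) (B : atlas R b)
    (F : atlas R p) (gB : tensor2 B) (gF : tensor2 F) (f : B -> R)
    : tensor2 (prod_atlas B F) :=
  fun i u => block_mx (gB i.1 (lsubmx u)) 0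
                      0 (f (param i.1 (lsubmx u)) ^+ 2 *: gF i.2 (rsubmx u)).

(** Tangent spaces of the two factors of a product, in a product chart. *)
Definition first_factor (R : realType) (b p : nat) : 'M[R]_(b, b + p) :=
  row_mx 1%:M 0.

Definition second_factor (R : realType) (b p : nat) : 'M[R]_(p, b + p) :=
  row_mx 0 1%:M.

(** The images of the two distributions in the ambient tangent space. *)
Definition Dtop (R : realType) (b p n : nat)
    (phi : 'rV[R]_(b + p) -> 'rV[R]_n) (u : 'rV[R]_(b + p)) : 'M[R]_(b, n) :=
  first_factor R b p *m jacobian phi u.

Definition Dperp (R : realType) (b p n : nat)
    (phi : 'rV[R]_(b + p) -> 'rV[R]_n) (u : 'rV[R]_(b + p)) : 'M[R]_(p, n) :=
  second_factor R b p *m jacobian phi u.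

(** [B] and [F] are identified with the leaves [phi (B x {y})] and
    [phi ({x} x F)]: the invariance of the former and the anti-invariance of
    the latter are part of [prw_invariant] and [prw_anti_invariant]. *)
Record PR_warped_product (R : realType) (n b p : nat) (N : atlas R n)
    (G P : tensor2 N) (B : atlas R b) (gB : tensor2 B) (F : atlas R p)
    (gF : tensor2 F) (f : B -> R) (phi : prod_atlas B F -> N) : Prop := {
  prw_base : smooth_manifold B;
  prw_fiber : smooth_manifold F;
  prw_gB : pseudo_riemannian_metric gB;
  prw_gF : pseudo_riemannian_metric gF;
  prw_f_smooth : smooth_function f;
  prw_f_pos : forall x, 0 < f x;
  prw_f_nonconst : ~ (exists c, forall x, f x = c);
  prw_sub : pseudo_riemannian_submanifold G phi;
  prw_warped : forall i a u, overlap phi i a u ->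
    pullback (G a) (loc phi i a) u = warped_metric gB gF f i u;
  prw_invariant : forall i a u, overlap phi i a u ->
    (Dtop (loc phi i a) u *m P a (loc phi i a u)
     == Dtop (loc phi i a) u)%MS;
  prw_anti_invariant : forall i a u, overlap phi i a u ->
    (Dperp (loc phi i a) u *m P a (loc phi i a u)
     <= normal_space (G a) (loc phi i a) u)%MS }.

(** The bundle [P Dperp] and its orthogonal complement [nu] in the normal
    bundle; [P] is the ambient endomorphism in the ambient chart. *)
Definition PDperp (R : realType) (b p n : nat) (P : 'rV[R]_n -> 'M[R]_n)
    (phi : 'rV[R]_(b + p) -> 'rV[R]_n) (u : 'rV[R]_(b + p)) : 'M[R]_n :=
  <<Dperp phi u *m P (phi u)>>%MS.

Definition nu_space (R : realType) (b p n : nat) (G P : 'rV[R]_n -> 'M[R]_n)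
    (phi : 'rV[R]_(b + p) -> 'rV[R]_n) (u : 'rV[R]_(b + p)) : 'M[R]_n :=
  (normal_space G phi u :&: orthogonal_space (G (phi u)) (PDperp P phi u))%MS.

(** The nu-component of [sff] along the decomposition of the normal space
    into [nu] and [P Dperp]. *)
Definition sff_nu (R : realType) (b p n : nat) (G P : 'rV[R]_n -> 'M[R]_n)
    (phi : 'rV[R]_(b + p) -> 'rV[R]_n)
    (X Y : 'rV[R]_(b + p) -> 'rV[R]_(b + p)) (u : 'rV[R]_(b + p)) : 'rV[R]_n :=
  sff G phi X Y u *m proj_mx (nu_space G P phi u) (PDperp P phi u).

Definition normal_parallel_PDperp (R : realType) (n b p : nat) (N : atlas R n)
    (G P : tensor2 N) (B : atlas R b) (F : atlas R p)
    (phi : prod_atlas B F -> N) : Prop :=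
  forall (i : idx (prod_atlas B F)) (a : idx N) (A : set 'rV[R]_(b + p))
    (U Z : 'rV[R]_(b + p) -> 'rV[R]_(b + p)),
  open A -> A `<=` overlap phi i a -> smooth_on A U -> smooth_on A Z ->
  (forall u, A u -> (Z u <= second_factor R b p)%MS) ->
  forall u, A u ->
    (normal_connection (G a) (loc phi i a) U
       (fun x => push (loc phi i a) Z x *m P a (loc phi i a x)) u
     <= PDperp (P a) (loc phi i a) u)%MS.

(* Main.v *)
Require Import Defs.
From HB Require Import structures.
From mathcomp Require Import all_boot all_order all_algebra.
From mathcomp Require Import all_classical all_reals all_analysis.
From mathcomp Require Import ring lra.
Set Implicit Arguments.
Unset Strict Implicit.
Unset Printing Implicit Defensive.
Import Order.TTheory GRing.Theory Num.Theory.
Import numFieldNormedType.Exports.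
Local Open Scope classical_set_scope.
Local Open Scope ring_scope.

(** The idea.  The second fundamental form sigma is bilinear and symmetric, so
    its signed square norm is a contraction with the inverse metric and is the
    same for every orthonormal frame ([signed_sqnorm_frame]).  At a point one
    may thus use a frame adapted to [TM = D + Dperp], and the norm splits into
    the blocks (D, D), twice (D, Dperp), and (Dperp, Dperp).

    Everything rests on one identity, [sff_tensor_P]: differentiating
    [g(X, P Z) = 0] for X in D and Z in Dperp, with P parallel and skew, gives
    [g(sigma(V, X), P Z) = g(P X, nabla_V Z)].  As [P X] is tangent, the right
    side is given by the Koszul formula of the warped metric.  It vanishes for
    V in D, hence sigma(D, D) is its own nu-component.  For V in Dperp it is
    [- (P X ln f) g(V, Z)].  The hypothesis on the normal connection says that
    sigma(., Dperp) has no nu-component ([sff_tensor_fiber_nu]), because P is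
    parallel and preserves nu; hence sigma(X, Z) = (P X ln f) P Z.

    The isometry sign of P, [g(P v, P w) = - g(v, w)], has two effects.  The
    bundle [P Dperp] is negative definite, so the (Dperp, Dperp) block is
    nonpositive, which is the only inequality in the proof.  And P turns an
    orthonormal frame of D into one with opposite signs, so the mixed blocks,
    [- 2 p] times the signed sum of the [(P X ln f)^2], equal
    [2 p] times the square norm of the gradient of [ln f].  This linear algebra
    is [signed_sqnorm_le].

    The differential calculus behind it is the symmetry of second derivatives
    ([derive_comm]) and the Koszul formula for the Christoffel symbols
    ([christoffel_vec_koszul]); from them follow the metric compatibility and
    the symmetry of the connection along the immersion, and the fact that the
    Gauss formula defines a normal vector ([gauss_formula]). *)

(** * Inner products, orthonormal frames and the algebraic inequality *)

Section Inner.
Variables (R : realType) (n : nat).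
Implicit Types (g : 'M[R]_n) (v w : 'rV[R]_n).

Lemma inner_linearl g w : linear (inner g ^~ w : 'rV[R]_n -> R^o).
Proof.
by move=> a u v; rewrite /inner !mulmxDl -!scalemxAl !mxE.
Qed.

Lemma inner_linearr g v : linear (inner g v : 'rV[R]_n -> R^o).
Proof.
by move=> a u w; rewrite /inner linearP /= mulmxDr -scalemxAr !mxE.
Qed.

Lemma innerDl g u v w : inner g (u + v) w = inner g u w + inner g v w.
Proof. by rewrite -[u]scale1r inner_linearl scale1r /= !scale1r. Qed.

Lemma innerDr g u v w : inner g u (v + w) = inner g u v + inner g u w.
Proof. by rewrite -[v]scale1r inner_linearr scale1r /= !scale1r. Qed.

Lemma inner0l g w : inner g 0 w = 0.
Proof. by rewrite /inner !mul0mx mxE. Qed.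

Lemma inner0r g w : inner g w 0 = 0.
Proof. by rewrite /inner trmx0 mulmx0 mxE. Qed.

Lemma innerZl g a v w : inner g (a *: v) w = a * inner g v w.
Proof. by rewrite -[a *: v]addr0 inner_linearl inner0l addr0. Qed.

Lemma innerZr g a v w : inner g v (a *: w) = a * inner g v w.
Proof. by rewrite -[a *: w]addr0 inner_linearr inner0r addr0. Qed.

Lemma innerNl g v w : inner g (- v) w = - inner g v w.
Proof. by rewrite -scaleN1r innerZl mulN1r. Qed.

Lemma innerNr g v w : inner g v (- w) = - inner g v w.
Proof. by rewrite -scaleN1r innerZr mulN1r. Qed.

Lemma inner_suml g w k (F : 'I_k -> 'rV[R]_n) :
  inner g (\sum_i F i) w = \sum_i inner g (F i) w.
Proof.
by apply: (big_morph (inner g ^~ w)) => [u v|]; rewrite ?innerDl ?inner0l.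
Qed.

Lemma inner_sumr g w k (F : 'I_k -> 'rV[R]_n) :
  inner g w (\sum_i F i) = \sum_i inner g w (F i).
Proof.
by apply: (big_morph (inner g w)) => [u v|]; rewrite ?innerDr ?inner0r.
Qed.

Lemma inner_trmx g v w : inner g^T v w = inner g w v.
Proof.
by rewrite /inner -[w *m g *m v^T]trmxK [RHS]mxE !trmx_mul trmxK mulmxA.
Qed.

Lemma innerC g : g^T = g -> forall v w, inner g v w = inner g w v.
Proof. by move=> gs v w; rewrite -{1}gs inner_trmx. Qed.

Lemma inner_eq0 g v : g \in unitmx -> (forall w, inner g v w = 0) -> v = 0.
Proof.
move=> gu h; have vg0 : v *m g = 0.
  apply/rowP => k; have := h (delta_mx 0 k).
  by rewrite /inner trmx_delta -colE mxE => ->; rewrite mxE.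
by rewrite -[v](mulmxK gu) vg0 mul0mx.
Qed.

Lemma inner_mul (m : nat) (A : 'M[R]_(m, n)) g (v w : 'rV[R]_m) :
  inner (A *m g *m A^T) v w = inner g (v *m A) (w *m A).
Proof. by rewrite /inner trmx_mul !mulmxA. Qed.

Lemma inner_delta g i j : inner g (delta_mx 0 i) (delta_mx 0 j) = g i j.
Proof. by rewrite /inner trmx_delta -rowE -colE !mxE. Qed.

Lemma inner_row (m : nat) (E : 'M[R]_(m, n)) g (s t : 'I_m) :
  inner g (row s E) (row t E) = (E *m g *m E^T) s t.
Proof.
by rewrite /inner -row_mul !mxE; apply: eq_bigr => k _; rewrite !mxE.
Qed.

End Inner.

Lemma linear_suml (R : realType) (V W : lmodType R) (f : V -> W) k
    (a : 'I_k -> R) (F : 'I_k -> V) : linear f ->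
  f (\sum_i a i *: F i) = \sum_i a i *: f (F i).
Proof.
move=> fl; have f0 : f 0 = 0.
  by apply: (addrI (1 *: f 0)); rewrite -fl scale1r addr0 scale1r addr0.
apply: (big_ind2 (fun x y => f x = y)) => // [x fx y fy <- <-|i _].
  by rewrite -[x]scale1r fl !scale1r.
by rewrite -[a i *: _]addr0 fl f0 addr0.
Qed.

Section Trace.
Variables (R : realType) (m : nat).

(** The coefficients on the right are the entries of a matrix that, for an
    orthonormal frame, is the inverse of the metric; this removes the frame. *)
Lemma signed_trace_contraction (q : 'rV[R]_m -> 'rV[R]_m -> R^o)
    (E : 'M[R]_m) (eps : 'rV[R]_m) :
  (forall w, linear (q ^~ w)) -> (forall v, linear (q v)) ->
  \sum_s eps 0 s * q (row s E) (row s E) =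
  \sum_i \sum_k (E^T *m diag_mx eps *m E) i k
                * q (delta_mx 0 i) (delta_mx 0 k).
Proof.
move=> ql qr.
transitivity (\sum_s \sum_i \sum_k
   (eps 0 s * (E s i * E s k)) * q (delta_mx 0 i) (delta_mx 0 k)).
  apply: eq_bigr => s _; rewrite [row s E]row_sum_delta.
  rewrite (linear_suml (f := q ^~ _)) // mulr_sumr; apply: eq_bigr => i _.
  rewrite linear_suml // scaler_sumr mulr_sumr; apply: eq_bigr => k _.
  by rewrite /GRing.scale /= !mxE; ring.
rewrite exchange_big /=; apply: eq_bigr => i _.
rewrite exchange_big /=; apply: eq_bigr => k _.
rewrite mxE mulr_suml; apply: eq_bigr => s _; congr (_ * _).
rewrite mul_mx_diag !mxE; ring.
Qed.

Lemma orthonormal_invmx (g E : 'M[R]_m) (eps : 'rV[R]_m) :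
  g \in unitmx -> (forall s, eps 0 s * eps 0 s = 1) ->
  E *m g *m E^T = diag_mx eps -> E^T *m diag_mx eps *m E = invmx g.
Proof.
move=> gu e2 EgE.
have ee : diag_mx eps *m diag_mx eps = 1%:M.
  rewrite mulmx_diag; apply/matrixP => s t; rewrite !mxE.
  by case: eqP => // _; rewrite e2.
have h1 : (E *m g) *m (E^T *m diag_mx eps) = 1%:M by rewrite mulmxA EgE.
have h2 : (E^T *m diag_mx eps *m E) *m g = 1%:M.
  by rewrite -[LHS]mulmxA (mulmx1C h1).
by rewrite -[LHS](mulmxK gu) h2 mul1mx.
Qed.

Lemma signed_trace_frame (g : 'M[R]_m) (q : 'rV[R]_m -> 'rV[R]_m -> R^o)
    (E E' : 'M[R]_m) (eps eps' : 'rV[R]_m) :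
  g \in unitmx ->
  (forall s, eps 0 s * eps 0 s = 1) -> (forall s, eps' 0 s * eps' 0 s = 1) ->
  E *m g *m E^T = diag_mx eps -> E' *m g *m E'^T = diag_mx eps' ->
  (forall w, linear (q ^~ w)) -> (forall v, linear (q v)) ->
  \sum_s eps 0 s * q (row s E) (row s E) =
  \sum_s eps' 0 s * q (row s E') (row s E').
Proof.
move=> gu e e' h h' ql qr; rewrite !signed_trace_contraction //.
by rewrite (orthonormal_invmx gu e h) (orthonormal_invmx gu e' h').
Qed.

(** A signed square norm is a double trace: the frame is exchanged in one
    argument at a time. *)
Lemma signed_sqnorm_frame (n : nat) (g : 'M[R]_m) (G : 'M[R]_n)
    (beta : 'rV[R]_m -> 'rV[R]_m -> 'rV[R]_n)
    (E E' : 'M[R]_m) (eps eps' : 'rV[R]_m) :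
  g \in unitmx ->
  (forall s, eps 0 s * eps 0 s = 1) -> (forall s, eps' 0 s * eps' 0 s = 1) ->
  E *m g *m E^T = diag_mx eps -> E' *m g *m E'^T = diag_mx eps' ->
  (forall w, linear (beta ^~ w)) -> (forall v, linear (beta v)) ->
  let S (E : 'M[R]_m) (eps : 'rV[R]_m) := \sum_s \sum_t eps 0 s * eps 0 t
     * inner G (beta (row s E) (row t E)) (beta (row s E) (row t E)) in
  S E eps = S E' eps'.
Proof.
move=> gu e e' h h' bl br S.
transitivity (\sum_s eps 0 s * \sum_t eps' 0 t
     * inner G (beta (row s E) (row t E')) (beta (row s E) (row t E'))).
  apply: eq_bigr => s _; under eq_bigr do rewrite -mulrA.
  rewrite -mulr_sumr; congr (_ * _).
  apply: (signed_trace_frame (q := fun v w =>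
    inner G (beta (row s E) v) (beta (row s E) w)) gu) => // v a w z.
    by rewrite br inner_linearl.
  by rewrite br inner_linearr.
transitivity (\sum_t eps' 0 t * \sum_s eps 0 s
     * inner G (beta (row s E) (row t E')) (beta (row s E) (row t E'))).
  under eq_bigr do rewrite mulr_sumr; rewrite exchange_big /=.
  apply: eq_bigr => t _; rewrite mulr_sumr; apply: eq_bigr => s _.
  by rewrite mulrCA.
rewrite /S exchange_big /=; apply: eq_bigr => t _.
under [RHS]eq_bigr do rewrite [_ * eps' 0 t]mulrC -mulrA.
rewrite -mulr_sumr; congr (_ * _).
apply: (signed_trace_frame (q := fun v w =>
    inner G (beta v (row t E')) (beta w (row t E'))) gu) => // v a w z.
  by rewrite bl inner_linearl.
by rewrite bl inner_linearr.
Qed.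

End Trace.

(** Gram-Schmidt: one step of elimination splits off the first coordinate and
    leaves the Schur complement, which is again positive definite. *)
Lemma posdef_orthonormal (R : realType) (p : nat) (h : 'M[R]_p) :
  h^T = h -> (forall v, v != 0 -> 0 < inner h v v) ->
  exists L : 'M[R]_p, L *m h *m L^T = 1%:M.
Proof.
elim: p h => [|p IH] h hs hp.
  by exists 1%:M; rewrite [LHS]flatmx0 [RHS]flatmx0.
move: h hs hp; rewrite -[p.+1]/(1 + p)%N => h hs hp.
rewrite -(submxK h) in hs hp *.
set a := ulsubmx h in hs hp *; set B := ursubmx h in hs hp *.
set B' := dlsubmx h in hs hp *; set c := drsubmx h in hs hp *.
move: hs; rewrite tr_block_mx => /eq_block_mx[_ B'E BE cs].
have a0 : 0 < a 0 0.
  have := hp (row_mx 1%:M 0); rewrite /inner mul_row_block tr_row_mx.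
  rewrite mul_row_col !mul1mx !mul0mx !addr0 trmx1 trmx0 mulmx1 mulmx0 addr0.
  apply; apply/eqP => /(congr1 lsubmx); rewrite row_mxKl linear0.
  by move/matrixP/(_ 0 0)/eqP; rewrite !mxE eqxx oner_eq0.
have aE : a = (a 0 0)%:M by rewrite [LHS]mx11_scalar.
move: (a 0 0) a0 aE => al a0 aE.
pose M : 'M[R]_(1 + p) := block_mx 1%:M 0 (- al^-1 *: B') 1%:M.
pose h2 : 'M[R]_p := c - al^-1 *: (B' *m B).
have MhM : M *m block_mx a B B' c *m M^T = block_mx a 0 0 h2.
  rewrite /M tr_block_mx !mulmx_block !mul1mx !mul0mx !addr0 !trmx1 !trmx0.
  rewrite !mulmx1 !mulmx0 !addr0 linearZ /= B'E.
  rewrite aE -!scalemxAr -!scalemxAl !mul_mx_scalar !mul_scalar_mx !scalerA.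
  rewrite mulNr mulVf ?gt_eqF // !scaleN1r.
  by rewrite !addNr mul0mx scaler0 add0r scaleNr /h2 addrC.
have h2p v : v != 0 -> 0 < inner h2 v v.
  (* The Schur complement inherits positivity: it is h on the vectors
     row_mx 0 v *m M. *)
  have -> : inner h2 v v = inner (block_mx a 0 0 h2) (row_mx 0 v) (row_mx 0 v).
    rewrite /inner mul_row_block !mul0mx !mulmx0 !add0r.
    by rewrite tr_row_mx mul_row_col mul0mx add0r.
  move=> v0; rewrite -MhM inner_mul; apply: hp.
  apply: contra v0 => /eqP; rewrite /M mul_row_block !mul0mx mulmx1 !add0r.
  by move/(congr1 rsubmx); rewrite row_mxKr linear0 => ->.
have h2s : h2^T = h2.
  by rewrite /h2 linearB linearZ /= trmx_mul BE B'E cs.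
have [L2 L2E] := IH _ h2s h2p.
pose D : 'M[R]_(1 + p) := block_mx (Num.sqrt al)^-1%:M 0 0 L2.
exists (D *m M); transitivity (D *m (M *m block_mx a B B' c *m M^T) *m D^T).
  by rewrite trmx_mul !mulmxA.
rewrite MhM /D tr_block_mx !mulmx_block.
rewrite !trmx0 !mulmx0 !mul0mx !addr0 !add0r L2E aE.
rewrite tr_scalar_mx -!scalar_mxM.
have r0 : Num.sqrt al != 0 by rewrite gt_eqF // sqrtr_gt0.
rewrite -{2}(sqr_sqrtr (ltW a0)) expr2 mulrA mulVf // mul1r mulfV //.
by rewrite !mul0mx -scalar_mx_block.
Qed.

Lemma trmx_mul3 (R : comNzRingType) m n k l (A : 'M[R]_(m, n))
    (B : 'M[R]_(n, k)) (C : 'M[R]_(k, l)) :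
  (A *m B *m C)^T = C^T *m B^T *m A^T.
Proof. by rewrite !trmx_mul mulmxA. Qed.

(** The geometry at one point: the rows of Jt and Jp span D and Dperp, those
    of J the tangent space, those of K the space P Dperp, and P is an
    anti-isometric involution of the ambient metric G. *)
Section LinearModel.
Variables (R : realType) (n b p : nat) (G P : 'M[R]_n).
Variables (Jt : 'M[R]_(b, n)) (Jp : 'M[R]_(p, n)) (gB : 'M[R]_b) (h : 'M[R]_p).
Variables (J : 'M[R]_(b + p, n)) (K : 'M[R]_(p, n)).
Hypothesis JE : J = col_mx Jt Jp.
Hypothesis KE : K = Jp *m P.
Hypothesis Gs : G^T = G.
Hypothesis Gu : G \in unitmx.
Hypothesis PP : P *m P = 1%:M.
Hypothesis PGP : P *m G *m P^T = - G.
Hypothesis JGJ : J *m G *m J^T = block_mx gB 0 0 h.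
Hypothesis gBu : gB \in unitmx.
Hypothesis hs : h^T = h.
Hypothesis hp : forall v, v != 0 -> 0 < inner h v v.
Hypothesis KGJ : K *m G *m J^T = 0.

Let JGJE : block_mx (Jt *m G *m Jt^T) (Jt *m G *m Jp^T)
               (Jp *m G *m Jt^T) (Jp *m G *m Jp^T) = block_mx gB 0 0 h.
Proof. by rewrite -JGJ JE tr_col_mx mul_col_mx mul_col_row. Qed.

Let gram_base : Jt *m G *m Jt^T = gB.
Proof. by case/eq_block_mx: JGJE. Qed.

Let gram_fiber : Jp *m G *m Jp^T = h.
Proof. by case/eq_block_mx: JGJE. Qed.

Let JGK : J *m G *m K^T = 0.
Proof. by rewrite -[LHS]trmxK trmx_mul3 trmxK Gs KGJ trmx0. Qed.

Let KGK : K *m G *m K^T = - h.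
Proof.
transitivity (Jp *m (P *m G *m P^T) *m Jp^T).
  by rewrite KE trmx_mul !mulmxA.
by rewrite PGP mulmxN mulNmx gram_fiber.
Qed.

Let hu : h \in unitmx.
Proof.
have [L LhL] := posdef_orthonormal hs hp.
have : L *m h *m L^T \in unitmx by rewrite LhL unitmx1.
by rewrite !unitmx_mul => /andP[/andP[]].
Qed.

Let gu : block_mx gB 0 0 h \in unitmx.
Proof. by rewrite unitmxE det_ublock unitrM -!unitmxE gBu hu. Qed.

(** The Gram matrix of K is [- h], so the span of K is nondegenerate. *)
Lemma rowspace_anti_orthogonal_eq0 (v : 'rV[R]_n) :
  (v <= K)%MS -> v *m G *m K^T = 0 -> v = 0.
Proof.
case/submxP => c ->; rewrite -!mulmxA (mulmxA K) KGK mulmxN => /eqP.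
rewrite oppr_eq0 => /eqP ch0.
by rewrite -[c](mulmxK hu) ch0 !mul0mx.
Qed.

Section Expansion.
Variable L : 'M[R]_p.
Hypothesis LhL : L *m h *m L^T = 1%:M.
Variable LK : 'M[R]_(p, n).
Hypothesis LKE : LK = L *m K.

Let Lu : L \in unitmx.
Proof.
have : L *m h *m L^T \in unitmx by rewrite LhL unitmx1.
by rewrite !unitmx_mul => /andP[/andP[]].
Qed.

Let LKGLK : LK *m G *m LK^T = - 1%:M.
Proof.
rewrite LKE trmx_mul -!mulmxA (mulmxA G) (mulmxA K) (mulmxA K) KGK.
by rewrite mulNmx mulmxN mulmxA LhL.
Qed.

Let JGLK : J *m G *m LK^T = 0.
Proof. by rewrite LKE trmx_mul mulmxA JGK mul0mx. Qed.

Let LKGJ : LK *m G *m J^T = 0.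
Proof. by rewrite LKE -!mulmxA (mulmxA K) KGJ mulmx0. Qed.

(** A normal vector orthogonal to every normal vector that is orthogonal to K
    lies in the span of K, where the rows of [L *m K] are orthonormal with all
    signs -1; this is Parseval's identity there, whence the minus sign. *)
Lemma normal_sqnorm (xi : 'rV[R]_n) :
  xi *m G *m J^T = 0 ->
  (forall eta : 'rV[R]_n, eta *m G *m J^T = 0 -> eta *m G *m K^T = 0 ->
     inner G xi eta = 0) ->
  inner G xi xi = - \sum_s inner G xi (row s L *m K) ^+ 2.
Proof.
move=> xiJ xinu.
(* The candidate expansion is xi = - c *m LK; the sign is that of LKGLK. *)
have [c cE] : exists c, xi *m G *m LK^T = c by eexists.
have w0 : xi + c *m LK = 0.
  apply: (inner_eq0 Gu) => y.
  (* The test vector y is split into its tangential part, its part in the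
     span of K, and a rest that the second hypothesis pairs to zero with xi. *)
  pose yT := y *m G *m J^T *m invmx (block_mx gB 0 0 h) *m J.
  pose yK := - (y *m G *m LK^T *m LK).
  have yE : y = yT + (yK + (y - yT - yK)).
    by rewrite (addrC yK) subrK addrC subrK.
  have wJ : (xi + c *m LK) *m G *m J^T = 0.
    by rewrite !mulmxDl xiJ add0r -!mulmxA (mulmxA LK) LKGJ mulmx0.
  have wLK : (xi + c *m LK) *m G *m LK^T = 0.
    by rewrite !mulmxDl cE -!mulmxA (mulmxA LK) LKGLK mulmxN mulmx1 addrN.
  have etaJ : (y - yT - yK) *m G *m J^T = 0.
    rewrite !mulmxBl /yT /yK !mulNmx -!mulmxA !(mulmxA LK) LKGJ !mulmx0.
    by rewrite !(mulmxA J) JGJ mulVmx // mulmx1 subrr oppr0 subr0.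
  have etaLK : (y - yT - yK) *m G *m LK^T = 0.
    rewrite !mulmxBl /yT /yK !mulNmx -!mulmxA !(mulmxA LK) LKGLK.
    by rewrite !(mulmxA J) JGLK !mulmx0 mulmxN !mulmxN mulmx1 opprK subr0 subrr.
  have etaK : (y - yT - yK) *m G *m K^T = 0.
    move: etaLK; rewrite LKE trmx_mul mulmxA => e.
    by rewrite -[LHS](mulmxK (_ : L^T \in unitmx)) ?unitmx_tr // e mul0mx.
  rewrite {1}yE 2!innerDr.
  have -> : inner G (xi + c *m LK) yT = 0.
    by rewrite /inner /yT trmx_mul mulmxA wJ mul0mx mxE.
  have -> : inner G (xi + c *m LK) yK = 0.
    by rewrite innerNr /inner trmx_mul mulmxA wLK mul0mx mxE oppr0.
  rewrite innerDl (xinu _ etaJ etaK) (innerC Gs (c *m LK)).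
  by rewrite /inner trmx_mul mulmxA etaLK mul0mx mxE !addr0.
have xiE : xi = - (c *m LK) by apply/eqP; rewrite -addr_eq0 w0.
have cs s : inner G xi (row s L *m K) = c 0 s.
  by rewrite /inner -row_mul -LKE tr_row colE mulmxA cE -colE mxE.
under eq_bigr do rewrite cs; rewrite xiE innerNl innerNr opprK.
rewrite -inner_mul LKGLK /inner mulmxN mulmx1 mulNmx !mxE; congr (- _).
by apply: eq_bigr => s _; rewrite mxE.
Qed.
End Expansion.

Section Inequality.
Variables (C : 'M[R]_b) (theta : 'rV[R]_b).
Variable beta : 'rV[R]_(b + p) -> 'rV[R]_(b + p) -> 'rV[R]_n.
Hypothesis JtP : Jt *m P = C *m Jt.
Hypothesis beta_l : forall w, linear (beta ^~ w).
Hypothesis beta_r : forall v, linear (beta v).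
Hypothesis betaC : forall v w, beta v w = beta w v.
Hypothesis beta_normal : forall v w, beta v w *m G *m J^T = 0.
Hypothesis beta_perp_top : forall z v w,
  inner G (beta (row_mx 0 z) (row_mx v 0)) (w *m K)
  = - (v *m C *m theta^T) 0 0 * inner h z w.
Hypothesis beta_perp_nu : forall v z eta,
  eta *m G *m J^T = 0 -> eta *m G *m K^T = 0 ->
  inner G (beta v (row_mx 0 z)) eta = 0.

(** Restricted to D, the map P is again an anti-isometric involution; this
    gives the mixed blocks the sign of the gradient term. *)
Let CgBC : C^T *m invmx gB *m C = - invmx gB.
Proof.
have CC : C *m C = 1%:M.
  have CCg : C *m C *m gB = gB.
    rewrite -gram_base !mulmxA -(mulmxA C C) -JtP mulmxA -JtP.
    by rewrite -(mulmxA Jt) PP mulmx1.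
  by rewrite -[LHS](mulmxK gBu) CCg mulmxV.
have CgC : C *m gB *m C^T = - gB.
  transitivity (Jt *m (P *m G *m P^T) *m Jt^T).
    by rewrite -gram_base !mulmxA -JtP -!mulmxA -!trmx_mul -JtP.
  by rewrite PGP mulmxN mulNmx gram_base.
have CCT : C^T *m C^T = 1%:M by rewrite -trmx_mul CC trmx1.
apply: (can_inj (mulmxK gBu)); rewrite mulNmx mulVmx //.
transitivity (C^T *m invmx gB *m (C *m gB *m C^T) *m C^T).
  by rewrite !mulmxA -[RHS]mulmxA CCT mulmx1.
by rewrite CgC mulmxN mulNmx mulmxKV // CCT.
Qed.

(** The frame [block_mx D 0 0 L] is adapted to the splitting.  Its mixed blocks
    are evaluated exactly, through the expansion in the rows of [L *m K]; its
    last block is minus a sum of squares. *)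
Lemma signed_sqnorm_le (E : 'M[R]_(b + p)) (D : 'M[R]_b)
    (eps : 'rV[R]_(b + p)) (del : 'rV[R]_b) :
  (forall s, eps 0 s * eps 0 s = 1) -> (forall s, del 0 s * del 0 s = 1) ->
  E *m block_mx gB 0 0 h *m E^T = diag_mx eps ->
  D *m gB *m D^T = diag_mx del ->
  \sum_s \sum_t eps 0 s * eps 0 t
     * inner G (beta (row s E) (row t E)) (beta (row s E) (row t E))
  <= 2 * p%:R * (theta *m invmx gB *m theta^T) 0 0
     + \sum_s \sum_t del 0 s * del 0 t
     * inner G (beta (row_mx (row s D) 0) (row_mx (row t D) 0))
               (beta (row_mx (row s D) 0) (row_mx (row t D) 0)).
Proof.
move=> e2 d2 EgE DgD.
have [L LhL] := posdef_orthonormal hs hp.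
have bperp v z : inner G (beta v (row_mx 0 z)) (beta v (row_mx 0 z))
    = - \sum_s inner G (beta v (row_mx 0 z)) (row s L *m K) ^+ 2.
  apply: (normal_sqnorm LhL (erefl _)) => [|eta]; first exact: beta_normal.
  exact: beta_perp_nu.
pose t s := (row s D *m C *m theta^T) 0 0.
have LL a c : inner h (row a L) (row c L) = (a == c)%:R.
  by rewrite inner_row LhL mxE.
have mixed s a : inner G (beta (row_mx (row s D) 0) (row_mx 0 (row a L)))
    (beta (row_mx (row s D) 0) (row_mx 0 (row a L))) = - t s ^+ 2.
  rewrite bperp betaC; congr (- _); rewrite (bigD1 a) //= big1 => [|c ca].
    rewrite beta_perp_top addr0.
    by rewrite LL eqxx mulr1 sqrrN.
  rewrite beta_perp_top LL eq_sym (negbTE ca) mulr0.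
  by rewrite expr0n.
pose E' : 'M[R]_(b + p) := block_mx D 0 0 L.
pose eps' : 'rV[R]_(b + p) := row_mx del (const_mx 1).
have EE' : E' *m block_mx gB 0 0 h *m E'^T = diag_mx eps'.
  rewrite /E' /eps' tr_block_mx !mulmx_block !trmx0 !(mulmx0, mul0mx).
  rewrite !(addr0, add0r, mulmx0, mul0mx) DgD LhL diag_mx_row.
  by rewrite diag_const_mx.
have e2' s : eps' 0 s * eps' 0 s = 1.
  rewrite /eps'; case: (split_ordP s) => a ->.
    by rewrite row_mxEl d2.
  by rewrite row_mxEr mxE mulr1.
have /= -> := signed_sqnorm_frame G gu e2 e2' EgE EE' beta_l beta_r.
have rl s : row (lshift p s) E' = row_mx (row s D) 0.
  by rewrite /E' rowKu row_row_mx linear0.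
have rr s : row (rshift b s) E' = row_mx 0 (row s L).
  by rewrite /E' rowKd row_row_mx linear0.
have el s : eps' 0 (lshift p s) = del 0 s by rewrite row_mxEl.
have er s : eps' 0 (rshift b s) = 1 by rewrite row_mxEr mxE.
have tsum : \sum_s del 0 s * t s ^+ 2 = - (theta *m invmx gB *m theta^T) 0 0.
  pose y := D *m C *m theta^T.
  transitivity ((y^T *m diag_mx del *m y) 0 0).
    rewrite mul_mx_diag mxE; apply: eq_bigr => s _.
    by rewrite /t -!row_mul -/y !mxE; ring.
  have -> : y^T *m diag_mx del *m y
      = theta *m (C^T *m (D^T *m diag_mx del *m D) *m C) *m theta^T.
    by rewrite /y trmx_mul3 trmxK !mulmxA.
  rewrite (orthonormal_invmx gBu d2 DgD) CgBC mulmxN mulNmx mxE.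
  by [].
have top s : \sum_r eps' 0 (lshift p s) * eps' 0 r
     * inner G (beta (row (lshift p s) E') (row r E'))
               (beta (row (lshift p s) E') (row r E')) =
   \sum_r del 0 s * del 0 r
     * inner G (beta (row_mx (row s D) 0) (row_mx (row r D) 0))
               (beta (row_mx (row s D) 0) (row_mx (row r D) 0))
   - p%:R * (del 0 s * t s ^+ 2).
  rewrite big_split_ord /=; congr (_ + _).
    by apply: eq_bigr => r _; rewrite !rl !el.
  rewrite (eq_bigr (fun=> - (del 0 s * t s ^+ 2))) => [|r _].
    by rewrite sumr_const card_ord mulNrn mulr_natl.
  by rewrite rl rr el er mixed mulr1 mulrN.
have perp s : \sum_r eps' 0 (rshift b s) * eps' 0 r
     * inner G (beta (row (rshift b s) E') (row r E'))
               (beta (row (rshift b s) E') (row r E')) <=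
   - \sum_r (del 0 r * t r ^+ 2).
  rewrite big_split_ord /= -[leRHS]addr0; apply: lerD.
    rewrite -sumrN; apply: ler_sum => r _.
    by rewrite rl rr el er betaC mixed mul1r mulrN.
  apply: sumr_le0 => r _.
  rewrite !rr !er bperp mulr1 mul1r oppr_le0.
  by apply: sumr_ge0 => c _; rewrite sqr_ge0.
rewrite big_split_ord /= (eq_bigr _ (fun s _ => top s)) big_split /=.
rewrite sumrN -mulr_sumr tsum.
have := ler_sum (index_enum 'I_p) (fun s (_ : true) => perp s).
rewrite sumr_const card_ord tsum opprK -[leRHS]mulr_natl => le_perp.
rewrite -(mulrA 2) mulrN opprK; move: le_perp.
by move: (p%:R * _) (\sum_(i < b) _) (\sum_(i < p) _) => x y z; lra.
Qed.
End Inequality.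
End LinearModel.

(** * Symmetry of second derivatives *)

Section SecondDerivative.
Variables (R : realType) (V : normedModType R) (f : V -> R) (u : V).
Hypothesis df : \forall z \near u, differentiable f z.

(** The second difference is symmetric in v and w while the leading term
    singles out one order of differentiation.  Differentiability of the first
    derivative at the single point u suffices, as in Young's theorem. *)
Lemma second_difference (v w : V) (e : R) :
  differentiable ('D_v f) u -> 0 < e ->
  exists2 d, 0 < d & forall t, 0 < t -> t < d ->
    `|f (t *: v + t *: w + u) - f (t *: w + u) - f (t *: v + u) + f u
      - t ^+ 2 * 'D_w ('D_v f) u| <= e * t ^+ 2.
Proof.
move=> dF e0; set F := 'D_v f.
(* N dominates |c v + t w| + |c v| over t for 0 < c < t; the summand 1 keeps
   it positive when v = w = 0. *)
pose N := 2 * `|v| + `|w| + 1.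
have N0 : 0 < N.
  by rewrite ltr_wpDl // addr_ge0 // mulr_ge0.
have : \forall z \near (0 : V), differentiable f (z + u) /\
    `|F (z + u) - F u - 'd F u z| <= e / N * `|z|.
  near=> z; split.
    near: z; rewrite near_simpl.
    have := near_shift 0 u (fun z => differentiable f z).
    by rewrite subr0 => <-.
  near: z; move/diff_locallyP: dF => [_ /eqaddoP /(_ (e / N))].
  rewrite divr_gt0 // => /(_ isT).
  by apply: filterS => z /=; rewrite /cst /= opprD addrA.
case/nbhs_ballP => r /= r0 hr.
exists (r / N) => [|t t0]; first exact: divr_gt0.
rewrite ltr_pdivlMr // => tr.
have small c : 0 <= c -> c <= t -> forall y, y = 0 \/ y = t *: w ->
    ball (0 : V) r (c *: v + y) /\ `|c *: v + y| <= t * (`|v| + `|w|).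
  move=> c0 ct y yE.
  have hn : `|c *: v + y| <= t * (`|v| + `|w|).
    rewrite (le_trans (ler_normD _ _)) // mulrDr lerD //.
      by rewrite normrZ ger0_norm // ler_wpM2r.
    case: yE => ->; first by rewrite normr0 mulr_ge0 // ltW.
    by rewrite normrZ gtr0_norm.
  split=> //; rewrite -ball_normE /ball_ /= sub0r normrN.
  rewrite (le_lt_trans hn) // (le_lt_trans _ tr) // ler_pM2l // /N.
  have := normr_ge0 v; lra.
(* The mean value theorem along v turns the second difference into
   t times an increment of the first derivative. *)
pose g := fun s => f (s *: v + t *: w + u) - f (s *: v + u).
pose dg := fun s => F (s *: v + t *: w + u) - F (s *: v + u).
have dgP s : 0 <= s -> s <= t -> is_derive s 1 g (dg s).
  move=> s0 st.
  have aux y : y = 0 \/ y = t *: w ->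
      is_derive s 1 (fun s : R => f (s *: v + y + u)) (F (s *: v + y + u)).
    move=> yE; have [/hr[dfs _] _] := small _ s0 st _ yE.
    pose k := (fun s : R => s *: v + y + u) : R -> V.
    have d1 : differentiable k s by [].
    have d2 : differentiable (f \o k) s.
      exact: (differentiable_comp (f := k)).
    rewrite -/(f \o k); apply: DeriveDef; first exact: diff_derivable.
    rewrite deriveE // (diff_comp (f := k)) //=.
    by rewrite /F deriveE // diff_val !addr0 /= scale1r.
  have h1 := aux _ (or_intror erefl).
  have := aux 0 (or_introl erefl); under eq_fun do rewrite addr0.
  by rewrite addr0 => h2; exact: is_deriveB.
have [c /[!in_itv]/= /andP[c0 ct] gE] :
    exists2 c, c \in `]0, t[ & g t - g 0 = dg c * (t - 0).
  apply: MVT => // [s /[!in_itv]/= /andP[s0 st]|].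
    by apply: dgP; apply: ltW.
  apply: derivable_within_continuous => s /[!in_itv]/= /andP[s0 st].
  exact: (@ex_derive _ _ _ _ _ _ _ (dgP s s0 st)).
have gE' : f (t *: v + t *: w + u) - f (t *: w + u) - f (t *: v + u) + f u
    = dg c * t.
  by rewrite -[t in RHS]subr0 -gE /g scale0r !add0r; ring.
rewrite gE'.
have [B1 n1] := small c (ltW c0) (ltW ct) _ (or_intror erefl).
have [B2 n2] := small c (ltW c0) (ltW ct) _ (or_introl erefl).
have [_ r1] := hr _ B1; have [_ r2] := hr _ B2.
rewrite addr0 in r2.
have n2' : `|c *: v| <= t * `|v|.
  by rewrite normrZ gtr0_norm // ler_wpM2r // ltW.
set r1' := F _ - _ - _ in r1; set r2' := F _ - _ - _ in r2.
have -> : dg c * t - t ^+ 2 * 'D_w F u = (r1' - r2') * t.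
  have -> : 'D_w F u = 'd F u w by exact: deriveE.
  have dl : 'd F u (c *: v + t *: w) = 'd F u (c *: v) + t * 'd F u w.
    by rewrite linearD [X in _ + X]linearZ.
  rewrite /r1' /r2' /dg dl; ring.
rewrite normrM (gtr0_norm t0) expr2 mulrA ler_pM2r //.
rewrite (le_trans (ler_normB _ _)) // (le_trans (lerD r1 r2)) // -mulrDr.
rewrite -mulrA ler_pM2l // mulrC ler_pdivrMr // /N.
rewrite (le_trans (lerD n1 n2')) //; nra.
Unshelve. all: by end_near. Qed.

End SecondDerivative.

(** Both mixed derivatives are the limit of the same second difference divided
    by [t ^+ 2]. *)
Lemma derive_comm (R : realType) (V : normedModType R) (f : V -> R)
    (u v w : V) :
  (\forall z \near u, differentiable f z) ->
  differentiable ('D_v f) u -> differentiable ('D_w f) u ->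
  'D_w ('D_v f) u = 'D_v ('D_w f) u.
Proof.
move=> df dv dw; apply/eqP; rewrite -subr_eq0 -normr_le0.
apply/ler_addgt0Pl => e e0; rewrite addr0.
have e20 : 0 < e / 2 by rewrite divr_gt0.
have [d d0 hd] := second_difference df w dv e20.
have [d' d'0 hd'] := second_difference df v dw e20.
pose t := Num.min d d' / 2.
have m0 : 0 < Num.min d d' by rewrite lt_min d0.
have t0 : 0 < t by rewrite divr_gt0.
have tm : t < Num.min d d' by rewrite /t ltr_pdivrMr // mulr_natr mulr2n ltrDl.
move: tm; rewrite lt_min => /andP[td td'].
have := hd t t0 td; have := hd' t t0 td'.
rewrite (addrC (t *: w) (t *: v)).
set a := f _; set b := f _; set c := f _ => h1 h2.
have t20 : 0 < t ^+ 2 by rewrite exprn_gt0.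
have xy : ('D_w ('D_v f) u - 'D_v ('D_w f) u) * t ^+ 2 =
    (a - b - c + f u - t ^+ 2 * 'D_v ('D_w f) u)
    - (a - c - b + f u - t ^+ 2 * 'D_w ('D_v f) u).
  move: ('D_v ('D_w f) u) ('D_w ('D_v f) u) (f u) => x y z; ring.
have h3 : `|('D_w ('D_v f) u - 'D_v ('D_w f) u) * t ^+ 2| <= e * t ^+ 2.
  rewrite xy (le_trans (ler_normB _ _)) // (le_trans (lerD h1 h2)) //.
  by rewrite -mulrDl -splitr.
by move: h3; rewrite normrM (gtr0_norm t20) ler_pM2r.
Qed.

(** * Matrix-valued functions and Christoffel symbols *)

(** The differential of f serves for g: the remainders agree near u. *)
Lemma near_eq_differentiable (R : realType) (V W : normedModType R)
    (f g : V -> W) u : (\forall z \near u, f z = g z) ->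
  differentiable f u -> differentiable g u.
Proof.
move=> fg; have fg0 := fg; move=> /diff_locallyP[fc /eqaddoP fo].
have go : g \o shift u = cst (g u) + 'd f u +o_ (0 : V) id.
  apply/eqaddoP => e e0; have := fo e e0.
  have := near_shift 0 u (fun z => f z = g z); rewrite subr0 => sh.
  rewrite sh in fg; move: fg; apply: filterS2 => z /= fz.
  have fu : f u = g u by exact: nbhs_singleton fg0.
  suff -> : (g \o shift u - (cst (g u) + 'd f u)) z
          = (f \o shift u - (cst (f u) + 'd f u)) z by [].
  have gE : g (z + u) - (g u + 'd f u z) = f (z + u) - (f u + 'd f u z).
    by rewrite fu -[g (z + u)]fz.
  exact: gE.
have dg := diff_unique fc go.
by apply/diff_locallyP; rewrite dg.
Qed.

Section MatrixCalculus.
Variables (R : realType) (V : normedModType R).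

Lemma differentiable_mxP m n (M : V -> 'M[R]_(m, n)) u :
  differentiable M u <-> forall i j, differentiable (fun z => M z i j) u.
Proof.
split=> [dM i j|dM].
  exact: (differentiable_comp dM (differentiable_coord (M u) i j)).
have -> : M = \sum_(i < m) \sum_(j < n) (fun z => M z i j *: delta_mx i j).
  apply/funext => z; rewrite [LHS]matrix_sum_delta fct_sumE.
  by apply: eq_bigr => i _; rewrite fct_sumE.
apply: differentiable_sum => i; apply: differentiable_sum => j.
exact: differentiableZl.
Qed.

Lemma derive_coord m n (M : V -> 'M[R]_(m, n)) u v i j :
  derivable M u v -> 'D_v (fun z => M z i j) u = 'D_v M u i j.
Proof. by move=> dM; rewrite derive_mx // mxE. Qed.

Lemma is_derive_mulmx m n k (M : V -> 'M[R]_(m, n)) (N : V -> 'M[R]_(n, k))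
    u v : derivable M u v -> derivable N u v ->
  is_derive u v (fun z => M z *m N z) ('D_v M u *m N u + M u *m 'D_v N u).
Proof.
move=> dM dN.
have h i j : is_derive u v (fun z => (M z *m N z) i j)
    (('D_v M u *m N u + M u *m 'D_v N u) i j).
  have -> : (fun z => (M z *m N z) i j)
      = \sum_(l < n) (fun z => M z i l * N z l j).
    by apply/funext => z; rewrite fct_sumE mxE.
  rewrite 3!mxE -big_split /=; apply: is_derive_sum => l.
  have /derivable_mxP dM' := dM; have /derivable_mxP dN' := dN.
  apply: is_derive_eq.
    exact: (is_deriveM (derivableP (dM' i l)) (derivableP (dN' l j))).
  rewrite !derive_coord // addrC; congr (_ + _).
  by rewrite /GRing.scale /= mulrC.
apply: DeriveDef.
  by apply/derivable_mxP => i j; have [] := h i j.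
rewrite derive_mx.
  by apply/matrixP => i j; rewrite mxE; have [_ ->] := h i j.
by apply/derivable_mxP => i j; have [] := h i j.
Qed.

Lemma is_derive_trmx m n (M : V -> 'M[R]_(m, n)) u v : derivable M u v ->
  is_derive u v (fun z => (M z)^T) ('D_v M u)^T.
Proof.
move=> dM; have dT : derivable (fun z => (M z)^T) u v.
  apply/derivable_mxP => i j; under eq_fun do rewrite mxE.
  by move/derivable_mxP : dM => /(_ j i).
apply: DeriveDef => //; rewrite derive_mx //.
apply/matrixP => i j; rewrite !mxE -derive_coord //.
by under eq_fun do rewrite mxE.
Qed.

Lemma is_derive_inner n (g : V -> 'M[R]_n) (X Y : V -> 'rV[R]_n) u v :
  derivable g u v -> derivable X u v -> derivable Y u v ->
  is_derive u v (fun z => inner (g z) (X z) (Y z))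
    (inner ('D_v g u) (X u) (Y u) + inner (g u) ('D_v X u) (Y u)
     + inner (g u) (X u) ('D_v Y u)).
Proof.
move=> dg dX dY.
have [d1 e1] := is_derive_mulmx dX dg.
have [d2 e2] := is_derive_trmx dY.
have [d3 e3] := is_derive_mulmx d1 d2.
apply: DeriveDef.
  by move/derivable_mxP : d3 => /(_ 0 0).
rewrite (derive_coord _ _ d3) e3 e1 e2 /inner mulmxDl mxE [X in X + _]mxE.
by congr (_ + _); rewrite addrC.
Qed.

Lemma derive_inner_cst n (g : V -> 'M[R]_n) (w z : 'rV[R]_n) u v :
  derivable g u v ->
  'D_v (fun t => inner (g t) w z) u = inner ('D_v g u) w z.
Proof.
move=> dg.
have [_ ->] := is_derive_inner dg (derivable_cst w u v) (derivable_cst z u v).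
by rewrite !derive_cst inner0l inner0r !addr0.
Qed.

Lemma differentiable_mulmx m n k (M : V -> 'M[R]_(m, n))
    (N : V -> 'M[R]_(n, k)) u :
  differentiable M u -> differentiable N u ->
  differentiable (fun z => M z *m N z) u.
Proof.
move=> /differentiable_mxP dM /differentiable_mxP dN.
apply/differentiable_mxP => i j.
have -> : (fun z => (M z *m N z) i j)
    = \sum_(l < n) (fun z => M z i l * N z l j).
  by apply/funext => z; rewrite fct_sumE mxE.
by apply: differentiable_sum => l; exact: differentiableM.
Qed.

Lemma differentiable_trmx m n (M : V -> 'M[R]_(m, n)) u :
  differentiable M u -> differentiable (fun z => (M z)^T) u.
Proof.
move=> /differentiable_mxP dM; apply/differentiable_mxP => i j.
by under eq_fun do rewrite mxE.
Qed.

Lemma derive_linear (W : normedModType R) (f : V -> W) u :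
  differentiable f u -> linear (fun v => 'D_v f u).
Proof. by move=> df a v w; rewrite !deriveE // linearP. Qed.

Lemma derive_comm_mx m n (f : V -> 'M[R]_(m, n)) (u v w : V) :
  (\forall z \near u, differentiable f z) ->
  differentiable ('D_v f) u -> differentiable ('D_w f) u ->
  'D_w ('D_v f) u = 'D_v ('D_w f) u.
Proof.
move=> df dv dw; apply/matrixP => i j.
have E x : \forall z \near u, 'D_x (fun z => f z i j) z = 'D_x f z i j.
  near=> z; rewrite derive_coord //; apply: diff_derivable; near: z; exact: df.
transitivity ('D_w (fun z => 'D_v f z i j) u).
  by symmetry; apply: derive_coord; exact: diff_derivable.
transitivity ('D_v (fun z => 'D_w f z i j) u); last first.
  by apply: derive_coord; exact: diff_derivable.
rewrite -(near_eq_derive w (E v)) -(near_eq_derive v (E w)).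
have EC x : \forall z \near u, 'D_x f z i j = 'D_x (fun z => f z i j) z.
  by apply: filterS (E x) => z ->.
apply: derive_comm.
- by apply: filterS df => z /differentiable_mxP.
- by apply: near_eq_differentiable (EC v) _; move/differentiable_mxP: dv.
- by apply: near_eq_differentiable (EC w) _; move/differentiable_mxP: dw.
Unshelve. all: by end_near. Qed.

End MatrixCalculus.

Section SmoothOn.
Variables (R : realType) (V W : normedModType R) (A : set V) (f : V -> W).
Hypothesis sf : smooth_on A f.

Lemma smooth_differentiable u : A u -> differentiable f u.
Proof. by move=> Au; have [+ _] := sf 1; apply. Qed.

Lemma smooth_derive v : smooth_on A ('D_v f).
Proof. by move=> k; have [_] := sf k.+1; apply. Qed.

Lemma smooth_onS (B : set V) : B `<=` A -> smooth_on B f.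
Proof.
move=> BA k; elim: k (f) (sf k) => [|k IH] h /=; first by move=> hc u /BA /hc.
by move=> [hd hD]; split=> [u /BA /hd //|v]; apply: IH.
Qed.

End SmoothOn.

Lemma smooth_cst (R : realType) (V W : normedModType R) (A : set V) (c : W) :
  smooth_on A (cst c).
Proof.
move=> k; elim: k c => [|k IH] c; first by move=> u _; exact: cvg_cst.
split=> [u _|v]; first exact: differentiable_cst.
have -> : (fun u : V => 'D_v (cst c) u) = cst 0; last exact: IH.
by apply/funext => u; rewrite derive_cst.
Qed.

Definition christoffel_vec (R : realType) n (g : 'rV[R]_n -> 'M[R]_n)
    (u v w : 'rV[R]_n) : 'rV[R]_n :=
  \row_(k < n) \sum_(i < n) \sum_(j < n)
    christoffel g u k i j * v 0 i * w 0 j.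

Section Koszul.
Variables (R : realType) (n : nat) (g : 'rV[R]_n -> 'M[R]_n) (u : 'rV[R]_n).

Lemma christoffel_vec_linearr v : linear (christoffel_vec g u v).
Proof.
move=> a w w'; apply/rowP => k; rewrite !mxE mulr_sumr -big_split /=.
apply: eq_bigr => i _; rewrite mulr_sumr -big_split /=.
by apply: eq_bigr => j _; rewrite !mxE; ring.
Qed.

Hypothesis dg : differentiable g u.
Hypothesis gs : \forall z \near u, (g z)^T = g z.

Lemma derive_symmetric v : ('D_v g u)^T = 'D_v g u.
Proof.
rewrite -[RHS](near_eq_derive v gs).
by have [_ ->] := is_derive_trmx (diff_derivable (v := v) dg).
Qed.

Lemma christoffel_vecC v w : christoffel_vec g u v w = christoffel_vec g u w v.
Proof.
apply/rowP => k; rewrite !mxE exchange_big /=; apply: eq_bigr => j _.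
apply: eq_bigr => i _; rewrite -!mulrA [v 0 i * _]mulrC; congr (_ * _).
rewrite /christoffel; congr (_ * _); apply: eq_bigr => l _; congr (_ * _).
have -> : partial l (fun x => g x i j) u = partial l (fun x => g x j i) u.
  apply: near_eq_derive; near=> z.
  by rewrite -{1}(near gs z) // mxE.
by rewrite [X in X - _]addrC.
Unshelve. all: by end_near. Qed.

Hypothesis gu : g u \in unitmx.

(** The Koszul formula with its index lowered: the factor [invmx g] in the
    Christoffel symbols is cancelled by the metric. *)
Lemma christoffel_vec_koszul v w z :
  inner (g u) (christoffel_vec g u v w) z =
  2^-1 * (inner ('D_v g u) w z + inner ('D_w g u) v z - inner ('D_z g u) v w).
Proof.
have dgE := derive_linear dg.
pose k v w l := inner ('D_v g u) w (delta_mx 0 l)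
   + inner ('D_w g u) v (delta_mx 0 l) - inner ('D_(delta_mx 0 l) g u) v w.
have partialE i j l : partial i (fun x => g x j l) u
    = inner ('D_(delta_mx 0 i) g u) (delta_mx 0 j) (delta_mx 0 l).
  by rewrite inner_delta /partial derive_coord //; exact: diff_derivable.
have innerD v' a b : inner ('D_v' g u) a b
    = \sum_i v' 0 i * inner ('D_(delta_mx 0 i) g u) a b.
  rewrite [v' in LHS]row_sum_delta (linear_suml _ _ dgE) /inner.
  by rewrite mulmx_sumr mulmx_suml summxE; apply: eq_bigr => i _;
     rewrite -scalemxAr -scalemxAl mxE.
have innerE' h a b : inner h a b = \sum_i \sum_j a 0 i * b 0 j *
    inner h (delta_mx 0 i) (delta_mx 0 j).
  rewrite {1}[a]row_sum_delta {1}[b]row_sum_delta inner_suml.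
  apply: eq_bigr => i _; rewrite inner_sumr; apply: eq_bigr => j _.
  by rewrite innerZl innerZr mulrA.
have chrE : christoffel_vec g u v w
    = (\row_l (2^-1 * k v w l)) *m (invmx (g u))^T.
  apply/rowP => m; rewrite !mxE.
  transitivity (\sum_i \sum_j \sum_l 2^-1 * invmx (g u) m l *
     (v 0 i * w 0 j * (partial i (fun x => g x j l) u
       + partial j (fun x => g x i l) u - partial l (fun x => g x i j) u))).
    apply: eq_bigr => i _; apply: eq_bigr => j _.
    rewrite /christoffel -!mulrA mulr_suml mulr_sumr.
    by apply: eq_bigr => l _; ring.
  under eq_bigr do rewrite exchange_big; rewrite exchange_big /=.
  apply: eq_bigr => l _; rewrite !mxE.
  have T1 : inner ('D_v g u) w (delta_mx 0 l)
      = \sum_i \sum_j v 0 i * w 0 j * partial i (fun x => g x j l) u.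
    rewrite innerD; apply: eq_bigr => i _.
    rewrite {1}[w]row_sum_delta inner_suml mulr_sumr; apply: eq_bigr => j _.
    by rewrite innerZl partialE mulrA.
  have T2 : inner ('D_w g u) v (delta_mx 0 l)
      = \sum_i \sum_j v 0 i * w 0 j * partial j (fun x => g x i l) u.
    rewrite innerD exchange_big /=; apply: eq_bigr => i _.
    rewrite {1}[v]row_sum_delta inner_suml mulr_sumr; apply: eq_bigr => j _.
    by rewrite innerZl partialE mulrA [w 0 _ * _]mulrC.
  have T3 : inner ('D_(delta_mx 0 l) g u) v w
      = \sum_i \sum_j v 0 i * w 0 j * partial l (fun x => g x i j) u.
    rewrite innerE'; apply: eq_bigr => i _; apply: eq_bigr => j _.
    by rewrite partialE.
  rewrite /k T1 T2 T3 -big_split -sumrB mulrAC mulr_sumr; apply: eq_bigr => i _.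
  rewrite -big_split -sumrB mulr_sumr; apply: eq_bigr => j _.
  by rewrite /=; ring.
have gsu := nbhs_singleton gs.
have inv_g : (invmx (g u))^T *m g u = 1%:M.
  by rewrite -{2}gsu -trmx_mul mulmxV // trmx1.
have -> : inner (g u) (christoffel_vec g u v w) z
    = \sum_l 2^-1 * k v w l * z 0 l.
  rewrite chrE /inner -[_ *m _ *m g u]mulmxA inv_g mulmx1 mxE.
  by apply: eq_bigr => l _; rewrite !mxE.
have expand (a : 'rV[R]_n -> R^o) : linear a ->
    a z = \sum_l z 0 l * a (delta_mx 0 l).
  by move=> al; rewrite [z in LHS]row_sum_delta linear_suml.
have e1 := expand _ (inner_linearr ('D_v g u) w).
have e2 := expand _ (inner_linearr ('D_w g u) v).
rewrite e1 e2 innerD -big_split -sumrB mulr_sumr; apply: eq_bigr => l _.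
have distribute (a d e c : R) :
  2^-1 * (a + d - e) * c = 2^-1 * (c * a + c * d - c * e) by ring.
exact: distribute.
Qed.

End Koszul.

(** * The connection along an immersion *)

Lemma derive_comp_mx (R : realType) (V : normedModType R) n k l
    (x : V -> 'rV[R]_n) (F : 'rV[R]_n -> 'M[R]_(k, l)) u v :
  differentiable x u -> differentiable F (x u) ->
  'D_v (fun t => F (x t)) u = 'D_('D_v x u) F (x u).
Proof.
move=> dx dF.
have d : differentiable (F \o x) u by apply: differentiable_comp.
rewrite [LHS](deriveE _ d) [in LHS]diff_comp //= (deriveE _ dF).
by congr ('d F _ _); rewrite deriveE.
Qed.

Section Immersion.
Variables (R : realType) (m n : nat) (G : 'rV[R]_n -> 'M[R]_n).
Variables (x : 'rV[R]_m -> 'rV[R]_n) (A : set 'rV[R]_m) (O : set 'rV[R]_n).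
Hypothesis oA : open A.
Hypothesis oO : open O.
Hypothesis xO : forall t, A t -> O (x t).
Hypothesis sx : smooth_on A x.
Hypothesis sG : smooth_on O G.
Hypothesis Gs : forall y, O y -> (G y)^T = G y.
Hypothesis Gu : forall y, O y -> G y \in unitmx.

Variable u : 'rV[R]_m.
Hypothesis Au : A u.

Let nearA : \forall t \near u, A t.
Proof. exact: open_nbhs_nbhs. Qed.

Let dx : differentiable x u.
Proof. exact: smooth_differentiable Au. Qed.

Let dG : differentiable G (x u).
Proof. by apply: (smooth_differentiable sG); apply: xO. Qed.

Let nearGs : \forall y \near x u, (G y)^T = G y.
Proof.
apply: filterS Gs _ => //=.
by apply: open_nbhs_nbhs; split => //; exact: xO.
Qed.

Let J := jacobian x.

Lemma jacobianE t v : A t -> v *m J t = 'D_v x t.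
Proof.
by move=> At; rewrite deriveEjacobian //; apply: smooth_differentiable At.
Qed.

Lemma differentiable_jacobian : differentiable J u.
Proof.
apply/differentiable_mxP => i j.
have : differentiable ('D_(delta_mx 0 i) x) u.
  by apply: (smooth_differentiable _ Au); exact: smooth_derive.
move/differentiable_mxP => /(_ 0 j); apply: near_eq_differentiable.
apply: filterS nearA => t At.
by rewrite -jacobianE // -rowE mxE.
Qed.

Lemma differentiable_push Y : differentiable Y u -> differentiable (push x Y) u.
Proof.
by move=> dY; apply: differentiable_mulmx dY differentiable_jacobian.
Qed.

Lemma differentiable_pullback : differentiable (pullback G x) u.
Proof.
have dJ := differentiable_jacobian.
apply: differentiable_mulmx; last exact: differentiable_trmx.
apply: differentiable_mulmx => //.
exact: (differentiable_comp (f := x)).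
Qed.

Lemma pullback_sym t : A t -> (pullback G x t)^T = pullback G x t.
Proof.
by move=> At; rewrite /pullback trmx_mul3 trmxK Gs //; apply: xO.
Qed.

Lemma inner_pullback t v w :
  inner (pullback G x t) v w = inner (G (x t)) (v *m J t) (w *m J t).
Proof. exact: inner_mul. Qed.

Lemma nabla_alongE v V : nabla_along G x (cst v) V u
  = 'D_v V u + christoffel_vec G (x u) (v *m J u) (V u).
Proof. by []. Qed.

(** Metric compatibility: by the Koszul formula, the two Christoffel terms add
    up to the derivative of the metric in the direction of the curve. *)
Lemma nabla_along_metric v V W :
  differentiable V u -> differentiable W u ->
  'D_v (fun t => inner (G (x t)) (V t) (W t)) u
  = inner (G (x u)) (nabla_along G x (cst v) V u) (W u)
    + inner (G (x u)) (V u) (nabla_along G x (cst v) W u).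
Proof.
move=> dV dW.
have dGx : differentiable (fun t => G (x t)) u.
  exact: (differentiable_comp (f := x)).
have [_ ->] := is_derive_inner (diff_derivable (v := v) dGx)
  (diff_derivable (v := v) dV) (diff_derivable (v := v) dW).
have chain : 'D_v (fun t => G (x t)) u = 'D_(v *m J u) G (x u).
  by rewrite jacobianE //; exact: derive_comp_mx.
rewrite chain !nabla_alongE innerDl innerDr; set a := v *m J u.
have Gsu := Gs (xO Au); have Guu := Gu (xO Au).
have E : inner ('D_a G (x u)) (V u) (W u)
    = inner (G (x u)) (christoffel_vec G (x u) a (V u)) (W u)
      + inner (G (x u)) (V u) (christoffel_vec G (x u) a (W u)).
  rewrite (innerC Gsu (V u)) !(christoffel_vec_koszul dG nearGs Guu).
  rewrite (innerC (derive_symmetric dG nearGs a) (W u)).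
  by lra.
by rewrite E; lra.
Qed.

Lemma derive_push v w : 'D_v (push x (cst w)) u = w *m 'D_v J u.
Proof.
have [_ ->] := is_derive_mulmx (derivable_cst w u v)
  (diff_derivable (v := v) differentiable_jacobian).
by rewrite derive_cst mul0mx add0r.
Qed.

Lemma derive_push_comm v w :
  'D_v (push x (cst w)) u = 'D_w (push x (cst v)) u.
Proof.
have E z : \forall t \near u, push x (cst z) t = 'D_z x t.
  by apply: filterS nearA => t At; rewrite -jacobianE.
rewrite (near_eq_derive v (E w)) (near_eq_derive w (E v)).
apply: derive_comm_mx.
- by apply: filterS nearA => t; apply: smooth_differentiable.
- by apply: (smooth_differentiable _ Au); exact: smooth_derive.
- by apply: (smooth_differentiable _ Au); exact: smooth_derive.
Qed.

(** The connection has no torsion: second derivatives of the immersion and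
    lower indices of the Christoffel symbols are both symmetric. *)
Lemma nabla_along_push_comm v w :
  nabla_along G x (cst v) (push x (cst w)) u
  = nabla_along G x (cst w) (push x (cst v)) u.
Proof.
by rewrite !nabla_alongE derive_push_comm (christoffel_vecC nearGs).
Qed.

Lemma derive_pullback v w z : inner ('D_v (pullback G x) u) w z =
  inner (G (x u)) (nabla_along G x (cst v) (push x (cst w)) u) (z *m J u)
  + inner (G (x u)) (w *m J u) (nabla_along G x (cst v) (push x (cst z)) u).
Proof.
rewrite -(nabla_along_metric _ (differentiable_push _) (differentiable_push _));
  try exact: differentiable_cst.
rewrite -(derive_inner_cst _ _ (diff_derivable differentiable_pullback)).
by congr ('D_v _ u); apply/funext => t; rewrite inner_pullback.
Qed.

(** Metric compatibility expresses each derivative of the pullback metric by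
    two covariant derivatives; the signs of the Koszul combination cancel all
    but one of them by the symmetry of the connection. *)
Lemma nabla_along_koszul v w z :
  inner (G (x u)) (nabla_along G x (cst v) (push x (cst w)) u) (z *m J u) =
  2^-1 * (inner ('D_v (pullback G x) u) w z + inner ('D_w (pullback G x) u) v z
          - inner ('D_z (pullback G x) u) v w).
Proof.
have Gsu := Gs (xO Au); have NC := nabla_along_push_comm.
have solve (a d e X Y Z : R) : X = a + d -> Y = a + e -> Z = d + e ->
  a = 2^-1 * (X + Y - Z) by move=> -> -> ->; lra.
apply: (solve _ (inner (G (x u)) (nabla_along G x (cst v) (push x (cst z)) u)
                   (w *m J u))
  (inner (G (x u)) (nabla_along G x (cst w) (push x (cst z)) u) (v *m J u))).
- by apply: (etrans (derive_pullback v w z)); congr (_ + _); exact: innerC.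
- apply: (etrans (derive_pullback w v z)); congr (_ + _); last exact: innerC.
  by rewrite NC.
- apply: (etrans (derive_pullback z v w)); rewrite NC (NC z w).
  by congr (_ + _); exact: innerC.
Qed.

(** The value at u of the second fundamental form on constant fields; the
    derivative of the jacobian is the second derivative of the immersion. *)
Definition sff_tensor (v w : 'rV[R]_m) : 'rV[R]_n :=
  w *m 'D_v J u + christoffel_vec G (x u) (v *m J u) (w *m J u)
  - christoffel_vec (pullback G x) u v w *m J u.

Lemma sff_tensorE v w : sff_tensor v w =
  nabla_along G x (cst v) (push x (cst w)) u
  - christoffel_vec (pullback G x) u v w *m J u.
Proof. by rewrite nabla_alongE derive_push. Qed.

(** The derivative of Y enters the ambient and the induced connection in the
    same way and cancels. *)
Lemma sff_tensorial X Y : differentiable Y u ->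
  sff G x X Y u = sff_tensor (X u) (Y u).
Proof.
move=> dY.
have [_ dJY] := is_derive_mulmx (diff_derivable (v := X u) dY)
  (diff_derivable (v := X u) differentiable_jacobian).
rewrite /sff /nabla_along /push /nabla dJY mulmxDl opprD addrA /sff_tensor.
congr (_ - _); rewrite addrC !addrA; congr (_ + _).
by rewrite -/J addNr add0r.
Qed.

Lemma sff_tensorC v w : sff_tensor v w = sff_tensor w v.
Proof.
rewrite !sff_tensorE nabla_along_push_comm; congr (_ - _ *m _).
by apply: christoffel_vecC; apply: filterS nearA => t; apply: pullback_sym.
Qed.

Lemma sff_tensor_linearr v : linear (sff_tensor v).
Proof.
move=> a w w'; rewrite /sff_tensor mulmxDl -scalemxAl.
rewrite (mulmxDl _ _ (J u)) -(scalemxAl _ _ (J u)).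
rewrite !christoffel_vec_linearr mulmxDl -scalemxAl scalerBr scalerDr opprD.
by rewrite [X in X + _ = _]addrACA [LHS]addrACA.
Qed.

Lemma sff_tensor_linearl w : linear (sff_tensor ^~ w).
Proof. by move=> a v v'; rewrite /= !(sff_tensorC _ w) sff_tensor_linearr. Qed.

Hypothesis gu : pullback G x u \in unitmx.

(** Both terms of the Gauss formula have the same tangential products, given
    by the Koszul expression of the pullback metric. *)
Lemma gauss_formula v w z : inner (G (x u)) (sff_tensor v w) (z *m J u) = 0.
Proof.
rewrite sff_tensorE innerDl innerNl nabla_along_koszul -inner_pullback.
rewrite christoffel_vec_koszul ?subrr //; first exact: differentiable_pullback.
by apply: filterS nearA => t; apply: pullback_sym.
Qed.

End Immersion.

(** * Derivatives of a warped product metric *)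

(** Lets a derivative treat as constant a factor that is constant in the given
    direction, without any regularity of that factor. *)
Lemma eq_derive_line (R : realType) (V W : normedModType R) (f g : V -> W) u v :
  (forall s : R, f (s *: v + u) = g (s *: v + u)) -> 'D_v f u = 'D_v g u.
Proof.
move=> fg; rewrite /derive.
suff -> : (fun s => s^-1 *: ((f \o shift u) (s *: v) - f u))
        = (fun s => s^-1 *: ((g \o shift u) (s *: v) - g u)) by [].
apply/funext => s /=; rewrite fg; congr (_ *: (_ - _)).
by have := fg 0; rewrite scale0r add0r.
Qed.

Lemma derive_ln (R : realType) (V : normedModType R) (k : V -> R) u v :
  differentiable k u -> 0 < k u ->
  differentiable (@ln R \o k) u /\ 'D_v (@ln R \o k) u = 'D_v k u / k u.
Proof.
move=> dk k0; have [dl le] := is_derive1_ln k0.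
have dl' : differentiable (@ln R) (k u) by apply/derivable1_diffP.
have d : differentiable (@ln R \o k) u by exact: differentiable_comp.
split=> //; rewrite (deriveE _ d) diff_comp //= (deriveE _ dk).
rewrite -le (deriveE _ dl') -[X in 'd _ _ X = _]mulr1.
by rewrite -[_ * 1]/(_ *: (1 : R^o)) linearZ.
Qed.

Lemma inner_block (R : realType) b p (a : 'M[R]_b) (d : 'M[R]_p)
    (v w : 'rV[R]_b) (v' w' : 'rV[R]_p) :
  inner (block_mx a 0 0 d) (row_mx v v') (row_mx w w')
  = inner a v w + inner d v' w'.
Proof.
rewrite /inner mul_row_block !mulmx0 addr0 add0r tr_row_mx mul_row_col.
by rewrite mxE.
Qed.

Section WarpedKoszul.
Variables (R : realType) (b p : nat) (g : 'rV[R]_(b + p) -> 'M[R]_(b + p)).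
Variables (gB : 'rV[R]_b -> 'M[R]_b) (gF : 'rV[R]_p -> 'M[R]_p).
Variables (F : 'rV[R]_b -> R) (u : 'rV[R]_(b + p)).
Hypothesis gE : \forall t \near u, g t =
  block_mx (gB (lsubmx t)) 0 0 (F (lsubmx t) ^+ 2 *: gF (rsubmx t)).
Hypothesis dg : differentiable g u.
Hypothesis dF : differentiable F (lsubmx u).
Hypothesis F0 : 0 < F (lsubmx u).

Let L (t : 'rV[R]_(b + p)) : R := ln (F (lsubmx t)).

Let dFl : differentiable (F \o lsubmx : 'rV[R]_(b + p) -> R) u.
Proof. by apply: differentiable_comp => //; exact: differentiable_lsubmx. Qed.

Lemma differentiable_lnF : differentiable L u.
Proof. by have [] := derive_ln 0 dFl F0. Qed.

Let D v w z : inner ('D_v g u) w z = 'D_v (fun t => inner (g t) w z) u.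
Proof. by rewrite derive_inner_cst //; exact: diff_derivable. Qed.

Lemma derive_warped_mixed v (w : 'rV[R]_b) (z : 'rV[R]_p) :
  inner ('D_v g u) (row_mx w 0) (row_mx 0 z) = 0.
Proof.
rewrite D -(derive_cst (0 : R) u v); apply: near_eq_derive.
by apply: filterS gE => t ->; rewrite inner_block inner0l inner0r addr0.
Qed.

Lemma derive_warped_mixed' v (w : 'rV[R]_b) (z : 'rV[R]_p) :
  inner ('D_v g u) (row_mx 0 z) (row_mx w 0) = 0.
Proof.
rewrite D -(derive_cst (0 : R) u v); apply: near_eq_derive.
by apply: filterS gE => t ->; rewrite inner_block inner0l inner0r addr0.
Qed.

(** The base block does not depend on the fibre coordinates. *)
Lemma derive_warped_base (v w : 'rV[R]_b) (z : 'rV[R]_p) :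
  inner ('D_(row_mx 0 z) g u) (row_mx v 0) (row_mx w 0) = 0.
Proof.
rewrite D.
have E : \forall t \near u, inner (g t) (row_mx v 0) (row_mx w 0)
    = inner (gB (lsubmx t)) v w.
  by apply: filterS gE => t ->; rewrite inner_block inner0l addr0.
rewrite (near_eq_derive _ E).
rewrite -(derive_cst (inner (gB (lsubmx u)) v w) u (row_mx 0 z)).
apply: eq_derive_line => s /=.
by rewrite linearD linearZ /= row_mxKl scaler0 add0r.
Qed.

(** In a base direction the fibre metric is constant and only the factor
    [F ^+ 2] varies. *)
Lemma derive_warped_fiber (v : 'rV[R]_b) (z z' : 'rV[R]_p) :
  inner ('D_(row_mx v 0) g u) (row_mx 0 z) (row_mx 0 z')
  = 2 * 'D_(row_mx v 0) L u * inner (g u) (row_mx 0 z) (row_mx 0 z').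
Proof.
have E : \forall t \near u, inner (g t) (row_mx 0 z) (row_mx 0 z')
    = F (lsubmx t) ^+ 2 * inner (gF (rsubmx t)) z z'.
  apply: filterS gE => t ->; rewrite inner_block inner0l add0r.
  by rewrite /inner -scalemxAr -scalemxAl mxE.
rewrite D (near_eq_derive _ E) (nbhs_singleton E).
set c := inner (gF _) z z'.
pose k := (F \o lsubmx) : 'rV[R]_(b + p) -> R.
transitivity ('D_(row_mx v 0) (c *: (k * k : _ -> R)) u).
  apply: eq_derive_line => s /=; rewrite mulrC -[RHS]/(c * (k _ * k _)) -expr2.
  congr (inner (gF _) _ _ * _).
  by rewrite linearD linearZ /= row_mxKr scaler0 add0r.
have dk : derivable k u (row_mx v 0) by exact: diff_derivable.
have [_ ->] := derive_ln (row_mx v 0) dFl F0.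
have dkk : derivable (k * k) u (row_mx v 0) by exact: derivableM.
rewrite (deriveZ c dkk) (deriveM dk dk) -/k.
rewrite -[F (lsubmx u)]/(k u).
have k0 : k u != 0 by rewrite gt_eqF.
by rewrite /GRing.scale /=; field.
Qed.

Lemma warped_koszul_base (v w : 'rV[R]_b) (z : 'rV[R]_p) :
  2^-1 * (inner ('D_(row_mx v 0) g u) (row_mx 0 z) (row_mx w 0)
    + inner ('D_(row_mx 0 z) g u) (row_mx v 0) (row_mx w 0)
    - inner ('D_(row_mx w 0) g u) (row_mx v 0) (row_mx 0 z)) = 0.
Proof.
rewrite derive_warped_mixed derive_warped_mixed' derive_warped_base.
by rewrite subr0 addr0 mulr0.
Qed.

Lemma warped_koszul_fiber (w : 'rV[R]_b) (z z' : 'rV[R]_p) :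
  2^-1 * (inner ('D_(row_mx 0 z) g u) (row_mx 0 z') (row_mx w 0)
    + inner ('D_(row_mx 0 z') g u) (row_mx 0 z) (row_mx w 0)
    - inner ('D_(row_mx w 0) g u) (row_mx 0 z) (row_mx 0 z'))
  = - 'D_(row_mx w 0) L u * inner (g u) (row_mx 0 z) (row_mx 0 z').
Proof.
rewrite !derive_warped_mixed' derive_warped_fiber.
have halve (d i : R) : 2^-1 * (0 + 0 - 2 * d * i) = - d * i by field.
exact: halve.
Qed.

End WarpedKoszul.

(** * The second fundamental form of a PR-warped product *)

Lemma orthogonal_spaceP (R : realType) k l n (g : 'M[R]_n) (B : 'M[R]_(k, n))
    (v : 'M[R]_(l, n)) :
  reflect (v *m g *m B^T = 0) (v <= orthogonal_space g <<B>>)%MS.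
Proof.
apply: (iffP sub_kermxP); rewrite mulmxA => h.
  have /submxP[Y {1}->] : (B <= <<B>>)%MS by rewrite genmxE.
  by rewrite trmx_mul mulmxA h mul0mx.
have /submxP[X ->] : (<<B>> <= B)%MS by rewrite genmxE.
by rewrite trmx_mul mulmxA h mul0mx.
Qed.

Lemma orthogonal_space_cap0 (R : realType) k n (g : 'M[R]_n)
    (B : 'M[R]_(k, n)) :
  B *m g *m B^T \in unitmx -> (orthogonal_space g <<B>> :&: <<B>> = 0)%MS.
Proof.
move=> gu; apply/eqP; rewrite -submx0; apply/rV_subP => v.
rewrite sub_capmx genmxE => /andP[/orthogonal_spaceP vB /submxP[c vE]].
move: vB; rewrite vE -!mulmxA (mulmxA B) => /(congr1 (mulmx^~ (invmx _))).
move=> /(_ (B *m g *m B^T)); rewrite mulmxK // mul0mx => ->.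
by rewrite mul0mx sub0mx.
Qed.

Lemma delta_mx_lshift (R : realType) b p (k : 'I_b) :
  delta_mx 0 (lshift p k) = row_mx (delta_mx 0 k) 0 :> 'rV[R]_(b + p).
Proof.
apply/rowP => j; case: (split_ordP j) => l ->; rewrite ?row_mxEl ?row_mxEr !mxE.
  by rewrite eq_lshift.
by rewrite eq_rlshift.
Qed.

Lemma delta_mx_rshift (R : realType) b p (k : 'I_p) :
  delta_mx 0 (rshift b k) = row_mx 0 (delta_mx 0 k) :> 'rV[R]_(b + p).
Proof.
apply/rowP => j; case: (split_ordP j) => l ->; rewrite ?row_mxEl ?row_mxEr !mxE.
  by rewrite eq_lrshift.
by rewrite eq_rshift.
Qed.

Lemma mul_orthogonal (R : realType) i j k n (z : 'M[R]_(i, j))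
    (M : 'M[R]_(j, n)) (g : 'M[R]_n) (B : 'M[R]_(k, n)) :
  M *m g *m B^T = 0 -> z *m M *m g *m B^T = 0.
Proof. by move=> h; rewrite -!mulmxA (mulmxA M) h mulmx0. Qed.

Lemma orthogonal_inner (R : realType) k n (g : 'M[R]_n) (B : 'M[R]_(k, n))
    (c : 'rV[R]_k) (v : 'rV[R]_n) :
  v *m g *m B^T = 0 -> inner g v (c *m B) = 0.
Proof. by move=> h; rewrite /inner trmx_mul mulmxA h mul0mx mxE. Qed.

(** The projection onto the normal space changes a vector by a tangent one,
    and eta does not see the difference. *)
Lemma inner_normal_proj (R : realType) k n (g : 'M[R]_n)
    (B : 'M[R]_(k, n)) (y eta : 'rV[R]_n) :
  g^T = g -> B *m g *m B^T \in unitmx -> eta *m g *m B^T = 0 ->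
  inner g (y *m proj_mx (orthogonal_space g <<B>>%MS) <<B>>%MS) eta
  = inner g y eta.
Proof.
move=> gs gu etaB; have cap0 := orthogonal_space_cap0 gu.
have sum1 : (y <= orthogonal_space g <<B>> + <<B>>)%MS.
  pose yT := y *m g *m B^T *m invmx (B *m g *m B^T) *m B.
  rewrite -[y](subrK yT) addmx_sub_adds ?genmxE ?submxMl //.
  apply/orthogonal_spaceP; rewrite !mulmxBl /yT -!mulmxA (mulmxA B).
  by rewrite mulVmx // mulmx1 subrr.
rewrite -{2}(add_proj_mx cap0 sum1) innerDl.
have : (y *m proj_mx <<B>> (orthogonal_space g <<B>>%MS) <= B)%MS.
  by rewrite -(genmxE B) proj_mx_sub.
case/submxP => c ->; rewrite (innerC gs (c *m B)).
have -> : inner g eta (c *m B) = 0 by exact: orthogonal_inner.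
by rewrite addr0.
Qed.

Lemma isometry_sign (R : realType) n (g P : 'M[R]_n) :
  (forall v w, inner g (v *m P) (w *m P) = - inner g v w) ->
  P *m g *m P^T = - g.
Proof.
move=> h; apply/matrixP => i j.
by rewrite -inner_row !rowE h inner_delta mxE.
Qed.

Section Parallel.
Variables (R : realType) (m n : nat) (G P : 'rV[R]_n -> 'M[R]_n).
Variables (x : 'rV[R]_m -> 'rV[R]_n) (u : 'rV[R]_m).
Hypothesis dx : differentiable x u.
Hypothesis dP : differentiable P (x u).
Hypothesis Ppar : forall v w,
  w *m 'D_v P (x u) + christoffel_vec G (x u) v (w *m P (x u))
  = christoffel_vec G (x u) v w *m P (x u).

(** A parallel endomorphism commutes with covariant differentiation along a
    map, by the chain rule. *)
Lemma nabla_along_parallel v V : differentiable V u ->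
  nabla_along G x (cst v) (fun t => V t *m P (x t)) u
  = nabla_along G x (cst v) V u *m P (x u).
Proof.
move=> dV; rewrite !nabla_alongE.
have dPx : differentiable (fun t => P (x t)) u.
  exact: (differentiable_comp (f := x)).
have [_ ->] := is_derive_mulmx (diff_derivable (v := v) dV)
  (diff_derivable (v := v) dPx).
have -> : 'D_v (fun t => P (x t)) u = 'D_(v *m jacobian x u) P (x u).
  by rewrite -deriveEjacobian //; exact: derive_comp_mx.
by rewrite -addrA Ppar mulmxDl.
Qed.
End Parallel.

(** A PR-warped product in charts: x is the immersion, O the domain of the
    ambient chart, and gB, gF and F are the metrics of the factors and the
    warping function in coordinates. *)
Section PRImmersion.
Variables (R : realType) (b p n : nat) (G P : 'rV[R]_n -> 'M[R]_n).
Variables (x : 'rV[R]_(b + p) -> 'rV[R]_n) (A : set 'rV[R]_(b + p)).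
Variable (O : set 'rV[R]_n).
Hypothesis oA : open A.
Hypothesis oO : open O.
Hypothesis xO : forall t, A t -> O (x t).
Hypothesis sx : smooth_on A x.
Hypothesis sG : smooth_on O G.
Hypothesis Gs : forall y, O y -> (G y)^T = G y.
Hypothesis Gu : forall y, O y -> G y \in unitmx.
Hypothesis sP : smooth_on O P.
Hypothesis PP : forall y, O y -> P y *m P y = 1%:M.
Hypothesis Pg : forall y, O y -> forall v w,
  inner (G y) (v *m P y) (w *m P y) = - inner (G y) v w.
Hypothesis Ppar : forall y, O y -> forall v w,
  w *m 'D_v P y + christoffel_vec G y v (w *m P y)
  = christoffel_vec G y v w *m P y.
Variables (gB : 'rV[R]_b -> 'M[R]_b) (gF : 'rV[R]_p -> 'M[R]_p).
Variables (F : 'rV[R]_b -> R) (u : 'rV[R]_(b + p)).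
Hypothesis Au : A u.
Hypothesis gE : forall t, A t -> pullback G x t =
  block_mx (gB (lsubmx t)) 0 0 (F (lsubmx t) ^+ 2 *: gF (rsubmx t)).
Hypothesis dF : differentiable F (lsubmx u).
Hypothesis F0 : 0 < F (lsubmx u).
Hypothesis gu : pullback G x u \in unitmx.
Hypothesis gBu : gB (lsubmx u) \in unitmx.
Hypothesis gFs : (gF (rsubmx u))^T = gF (rsubmx u).
Hypothesis gFp : forall v, v != 0 -> 0 < inner (gF (rsubmx u)) v v.
Hypothesis anti : forall t, A t ->
  (Dperp x t *m P (x t) <= Defs.normal_space G x t)%MS.
Hypothesis normal_parallel : forall v (z : 'rV[R]_p),
  (normal_connection G x (cst v)
     (fun t => push x (cst (row_mx 0 z)) t *m P (x t)) u
   <= PDperp P x u)%MS.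

Let nearA : \forall t \near u, A t.
Proof. exact: open_nbhs_nbhs. Qed.

Let J := jacobian x.
Let Jt := Dtop x u.
Let Jp := Dperp x u.
Let K := Jp *m P (x u).
Let h := F (lsubmx u) ^+ 2 *: gF (rsubmx u).
Let L (t : 'rV[R]_(b + p)) : R := ln (F (lsubmx t)).
Let beta := sff_tensor G x u.
Let Gx := G (x u).
Let N v w := nabla_along G x (cst v) (push x (cst w)) u.

Let JE : J u = col_mx Jt Jp.
Proof.
rewrite /Jt /Jp /Dtop /Dperp -mul_col_mx /first_factor /second_factor.
by rewrite -[col_mx _ _]/(block_mx _ _ _ _) -scalar_mx_block mul1mx.
Qed.

Lemma row_first_mul t (v : 'rV[R]_b) : row_mx v 0 *m J t = v *m Dtop x t.
Proof. by rewrite /Dtop mulmxA /first_factor mul_mx_row mulmx1 mulmx0. Qed.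

Lemma row_second_mul t (z : 'rV[R]_p) : row_mx 0 z *m J t = z *m Dperp x t.
Proof. by rewrite /Dperp mulmxA /second_factor mul_mx_row mulmx1 mulmx0. Qed.

Let Ox : O (x u). Proof. exact: xO. Qed.
Let Gxs : Gx^T = Gx. Proof. exact: Gs. Qed.

Lemma inner_P_skew (v w : 'rV[R]_n) :
  inner Gx (v *m P (x u)) w = - inner Gx v (w *m P (x u)).
Proof. by rewrite -[w in LHS]mulmx1 -(PP Ox) mulmxA Pg. Qed.

Let KGJ : K *m Gx *m (J u)^T = 0.
Proof. by apply/orthogonal_spaceP; exact: anti. Qed.

Let gxE : pullback G x u = block_mx (gB (lsubmx u)) 0 0 h.
Proof. exact: gE. Qed.

Let dg : differentiable (pullback G x) u.
Proof. exact: (differentiable_pullback oA xO sx sG Au). Qed.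

Let nearg : \forall t \near u, pullback G x t =
  block_mx (gB (lsubmx t)) 0 0 (F (lsubmx t) ^+ 2 *: gF (rsubmx t)).
Proof. by apply: filterS nearA => t; exact: gE. Qed.

Let koszul v w z := nabla_along_koszul oA oO xO sx sG Gs Gu Au v w z.

Lemma sff_tensor_normal v w : beta v w *m Gx *m (J u)^T = 0.
Proof.
apply/rowP => k; rewrite [RHS]mxE.
rewrite -(gauss_formula oA oO xO sx sG Gs Gu Au gu v w (delta_mx 0 k)).
by rewrite /inner -rowE tr_row colE mulmxA -colE [RHS]mxE.
Qed.

(** The induced connection only contributes a tangent vector. *)
Lemma inner_sff_tensor v w (eta : 'rV[R]_n) : eta *m Gx *m (J u)^T = 0 ->
  inner Gx (beta v w) eta = inner Gx (N v w) eta.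
Proof.
move=> etaJ; rewrite /beta (sff_tensorE G oA sx Au) innerDl innerNl.
rewrite (innerC Gxs (_ *m _)) [X in _ - X = _](_ : _ = 0) ?subr0 //.
exact: orthogonal_inner.
Qed.

Let dpush w : differentiable (push x (cst w)) u.
Proof. by apply: (differentiable_push oA sx Au); exact: differentiable_cst. Qed.

Lemma nabla_along_P v w :
  nabla_along G x (cst v) (fun t => push x (cst w) t *m P (x t)) u
  = N v w *m P (x u).
Proof.
apply: nabla_along_parallel => //.
- exact: smooth_differentiable Au.
- exact: (smooth_differentiable sP).
- exact: Ppar.
Qed.

(** The product [g(X, P Z)] vanishes identically; differentiating it and moving
    P across the metric exchanges the roles of the two fields. *)
Lemma sff_tensor_P v (w : 'rV[R]_b) (z : 'rV[R]_p) :
  inner Gx (beta v (row_mx w 0)) (z *m K)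
  = inner Gx (w *m Jt *m P (x u)) (N v (row_mx 0 z)).
Proof.
rewrite inner_sff_tensor; last exact: mul_orthogonal.
pose V := push x (cst (row_mx w 0)).
pose W t := push x (cst (row_mx 0 z)) t *m P (x t).
have dPx : differentiable (fun t => P (x t)) u.
  apply: (differentiable_comp (f := x)); first exact: smooth_differentiable Au.
  exact: (smooth_differentiable sP).
have dW : differentiable W u by exact: differentiable_mulmx.
have:= nabla_along_metric oO xO sx sG Gs Gu Au v (dpush (row_mx w 0)) dW.
rewrite nabla_along_P.
have -> : 'D_v (fun t => inner (G (x t)) (V t) (W t)) u = 0.
  rewrite -(derive_cst (0 : R) u v); apply: near_eq_derive.
  apply: filterS nearA => t At; rewrite /V /W /push /cst.
  rewrite (innerC (Gs (xO At))) row_second_mul -mulmxA.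
  have /orthogonal_spaceP KJ := anti At.
  exact/orthogonal_inner/mul_orthogonal.
have VE : V u = w *m Jt by exact: row_first_mul.
have WE : W u = z *m K.
  by rewrite /W [push _ _ _]row_second_mul -mulmxA.
move=> e; have : 0 = inner Gx (N v (row_mx w 0)) (W u)
  + inner Gx (V u) (N v (row_mx 0 z) *m P (x u)) := e.
by rewrite VE WE inner_P_skew => /esym/eqP; rewrite addr_eq0 => /eqP.
Qed.

Variable C : 'M[R]_b.
Hypothesis CE : Jt *m P (x u) = C *m Jt.

Let theta : 'rV[R]_b := \row_k 'D_(row_mx (delta_mx 0 k) 0) L u.

Lemma derive_lnF (v : 'rV[R]_b) : 'D_(row_mx v 0) L u = (v *m theta^T) 0 0.
Proof.
have dL := differentiable_lnF dF F0 : differentiable L u.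
have fl : linear (fun w : 'rV[R]_b => 'D_(row_mx w 0) L u).
  move=> a w w'; rewrite -(derive_linear dL) scale_row_mx add_row_mx.
  by rewrite scaler0 addr0.
rewrite [v in LHS]row_sum_delta (linear_suml _ _ fl) mxE.
by apply: eq_bigr => k _; rewrite !mxE.
Qed.

(** The base leaves are totally geodesic in the warped product, so the
    right-hand side of [sff_tensor_P] vanishes. *)
Lemma sff_tensor_base_P (v w : 'rV[R]_b) (z : 'rV[R]_p) :
  inner Gx (beta (row_mx v 0) (row_mx w 0)) (z *m K) = 0.
Proof.
rewrite sff_tensor_P -mulmxA CE mulmxA -row_first_mul (innerC Gxs) koszul.
exact: warped_koszul_base nearg dg v (w *m C) z.
Qed.

(** Here the fibre metric varies along the base by the warping function, and
    the right-hand side of [sff_tensor_P] is a derivative of [ln F]. *)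
Lemma sff_tensor_fiber_P (z : 'rV[R]_p) (v : 'rV[R]_b) (z' : 'rV[R]_p) :
  inner Gx (beta (row_mx 0 z) (row_mx v 0)) (z' *m K)
  = - (v *m C *m theta^T) 0 0 * inner h z z'.
Proof.
rewrite sff_tensor_P -mulmxA CE mulmxA -row_first_mul (innerC Gxs) koszul.
rewrite (warped_koszul_fiber nearg dg dF F0) derive_lnF gxE.
by rewrite inner_block inner0l add0r.
Qed.

(** The space nu is P-invariant, and the hypothesis says that the covariant
    derivative of [P Z] has no component in nu. *)
Lemma sff_tensor_fiber_nu v (z : 'rV[R]_p) (eta : 'rV[R]_n) :
  eta *m Gx *m (J u)^T = 0 -> eta *m Gx *m K^T = 0 ->
  inner Gx (beta v (row_mx 0 z)) eta = 0.
Proof.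
move=> etaJ etaK.
have PGT : P (x u) *m Gx = - (Gx *m (P (x u))^T).
  have <- : P (x u) *m Gx *m (P (x u))^T *m (P (x u))^T = - (Gx *m (P (x u))^T).
    by rewrite (isometry_sign (Pg Ox)) mulNmx.
  by rewrite -[RHS]mulmxA -trmx_mul (PP Ox) trmx1 mulmx1.
have skew k (B : 'M[R]_(k, n)) : eta *m P (x u) *m Gx *m B^T
    = - (eta *m Gx *m (B *m P (x u))^T).
  by rewrite -(mulmxA eta) PGT mulmxN mulNmx trmx_mul !mulmxA.
have [etaJt etaJp] : eta *m Gx *m Jt^T = 0 /\ eta *m Gx *m Jp^T = 0.
  move: etaJ; rewrite JE tr_col_mx mul_mx_row -[X in _ = X -> _]row_mx0.
  by move/eq_row_mx.
have etaPJ : eta *m P (x u) *m Gx *m (J u)^T = 0.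
  rewrite skew JE mul_col_mx CE tr_col_mx mul_mx_row trmx_mul mulmxA etaJt.
  by rewrite mul0mx [eta *m _ *m _]etaK row_mx0 oppr0.
have etaPK : eta *m P (x u) *m Gx *m K^T = 0.
  rewrite skew; have -> : K *m P (x u) = Jp by rewrite -mulmxA PP // mulmx1.
  by rewrite etaJp oppr0.
(* The vector eta is P applied to eta P, and P is skew and parallel, so the
   pairing becomes one of the derivative of P Z with eta P. *)
rewrite inner_sff_tensor // -[eta]mulmx1 -(PP Ox) mulmxA.
rewrite -[RHS]oppr0 -[LHS]opprK; congr (- _).
rewrite -inner_P_skew -nabla_along_P.
have := inner_normal_proj (nabla_along G x (cst v)
   (fun t => push x (cst (row_mx 0 z)) t *m P (x t)) u) Gxs gu etaPJ.
move=> <-.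
have /submxP[c cE] : (normal_connection G x (cst v)
     (fun t => push x (cst (row_mx 0 z)) t *m P (x t)) u <= K)%MS.
  by rewrite (submx_trans (normal_parallel v z)) // genmxE.
rewrite [X in inner _ X]cE (innerC Gxs).
exact: orthogonal_inner.
Qed.

Let hs : h^T = h.
Proof. by rewrite /h linearZ /= gFs. Qed.

Let hp (v : 'rV[R]_p) : v != 0 -> 0 < inner h v v.
Proof.
move=> v0; rewrite /h /inner -scalemxAr -scalemxAl mxE mulr_gt0 ?exprn_gt0 //.
exact: gFp.
Qed.

Let JGJ : J u *m Gx *m (J u)^T = block_mx (gB (lsubmx u)) 0 0 h.
Proof. exact: gxE. Qed.

Let PGP := isometry_sign (Pg Ox).

(** The function [ln F] depends on the base coordinates only, so its gradient
    involves only the base block of the inverse metric. *)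
Lemma sqnorm_gradient_lnF :
  let grad := gradient (pullback G x) L u in
  inner (pullback G x u) grad grad
  = (theta *m invmx (gB (lsubmx u)) *m theta^T) 0 0.
Proof.
rewrite /gradient; set dL := \row_k _.
have dLE : dL = row_mx theta 0.
  apply/rowP => k; rewrite mxE /partial; case: (split_ordP k) => l ->.
    by rewrite row_mxEl mxE delta_mx_lshift.
  rewrite row_mxEr mxE delta_mx_rshift.
  rewrite -(derive_cst (L u) u (row_mx 0 (delta_mx 0 l))).
  apply: eq_derive_line => r; rewrite /L /cst.
  by rewrite linearD linearZ /= row_mxKl scaler0 add0r.
have hu : h \in unitmx.
  by move: gu; rewrite gxE unitmxE det_ublock unitrM -!unitmxE => /andP[].
have gVE : invmx (pullback G x u)
    = block_mx (invmx (gB (lsubmx u))) 0 0 (invmx h).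
  apply: (can_inj (mulmxK gu)); rewrite mulVmx // gxE mulmx_block.
  rewrite !mulmx0 !mul0mx.
  by rewrite !addr0 !add0r !mulVmx // -scalar_mx_block.
have gVs : (invmx (pullback G x u))^T = invmx (pullback G x u).
  by rewrite trmx_inv (pullback_sym xO Gs Au).
rewrite /= /inner mulmxKV // trmx_mul gVs mulmxA dLE gVE.
rewrite mul_row_block !mulmx0 !mul0mx !addr0 tr_row_mx mul_row_col.
by rewrite mul0mx addr0.
Qed.

(** By [sff_tensor_base_P] the vector is already in nu, and the sum of nu and
    of the span of K is direct. *)
Lemma sff_nu_top (X Y : 'rV[R]_(b + p) -> 'rV[R]_(b + p)) (v w : 'rV[R]_b) :
  differentiable Y u -> X u = row_mx v 0 -> Y u = row_mx w 0 ->
  sff_nu G P x X Y u = beta (row_mx v 0) (row_mx w 0).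
Proof.
move=> dY Xu Yu; rewrite /sff_nu (sff_tensorial G oA sx Au X dY) Xu Yu.
apply: proj_mx_id.
  apply/eqP; rewrite -submx0; apply/rV_subP => y.
  rewrite sub_capmx => /andP[]; rewrite sub_capmx => /andP[_].
  move=> /orthogonal_spaceP yK; rewrite genmxE => yK'.
  rewrite (rowspace_anti_orthogonal_eq0 JE (erefl K) PGP JGJ hs hp yK' yK).
  exact: sub0mx.
rewrite sub_capmx; apply/andP; split; apply/orthogonal_spaceP.
  exact: sff_tensor_normal.
apply/rowP => k; rewrite [RHS]mxE -[RHS](sff_tensor_base_P v w (delta_mx 0 k)).
by rewrite /inner -rowE tr_row colE mulmxA -colE [RHS]mxE.
Qed.

Variables (e : 'I_(b + p) -> 'rV[R]_(b + p) -> 'rV[R]_(b + p)).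
Variables (d : 'I_b -> 'rV[R]_(b + p) -> 'rV[R]_(b + p)).
Hypothesis he : orthonormal_frame (pullback G x) A (fun _ => 1%:M) e.
Hypothesis hd : orthonormal_frame (pullback G x) A
  (fun _ => first_factor R b p) d.

Lemma orthonormal_frame_diag (k r : nat)
    (B : 'rV[R]_(b + p) -> 'M[R]_(k, b + p))
    (c : 'I_r -> 'rV[R]_(b + p) -> 'rV[R]_(b + p)) :
  let g := pullback G x in
  orthonormal_frame g A B c ->
  let E := \matrix_s c s u in
  let eps := \row_s inner (g u) (c s u) (c s u) in
  E *m g u *m E^T = diag_mx eps /\ forall s, eps 0 s * eps 0 s = 1.
Proof.
move=> g hc E eps; split.
  apply/matrixP => s t; rewrite -inner_row !rowK !mxE.
  have [->|st] := eqVneq s t; first by rewrite mulr1n.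
  by rewrite mulr0n (frame_orth hc).
move=> s; rewrite mxE; have [->|->] := frame_unit hc Au s; first exact: mulr1.
by rewrite mulrNN mulr1.
Qed.

Lemma chart_inequality :
  let g := pullback G x in
  let grad := gradient g L u in
  signed_sqnorm (g u) (G (x u)) e (sff G x) u
  <= 2 * p%:R * inner (g u) grad grad
     + signed_sqnorm (g u) (G (x u)) d (sff_nu G P x) u.
Proof.
rewrite /=; set g := pullback G x; set grad := gradient g L u.
have [EgE e2] := orthonormal_frame_diag he.
have [DgD d2] := orthonormal_frame_diag hd.
pose D := \matrix_s lsubmx (d s u).
have dE s : d s u = row_mx (row s D) 0.
  have /andP[/row_subP /(_ s) + _] := frame_span hd Au.
  rewrite rowK => /submxP[c cE].
  by rewrite rowK cE /first_factor mul_mx_row mulmx1 mulmx0 row_mxKl.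
have DgD' : D *m gB (lsubmx u) *m D^T
    = diag_mx (\row_s inner (g u) (d s u) (d s u)).
  rewrite -DgD; apply/matrixP => s t; rewrite -[LHS]inner_row -[RHS]inner_row.
  have rE r : row r (\matrix_s d s u) = row_mx (row r D) 0 by rewrite rowK.
  by rewrite !rE gxE inner_block inner0l addr0.
rewrite sqnorm_gradient_lnF.
have bl := sff_tensor_linearl oA oO xO sx Gs Au.
have br := sff_tensor_linearr G x u.
have bC := sff_tensorC oA oO xO sx Gs Au.
have EgE' : (\matrix_s e s u) *m block_mx (gB (lsubmx u)) 0 0 h
    *m (\matrix_s e s u)^T = diag_mx (\row_s inner (g u) (e s u) (e s u)).
  by rewrite -EgE gxE.
have main := signed_sqnorm_le JE (erefl K) Gxs (Gu Ox) (PP Ox) PGP JGJ gBu hs hp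
  KGJ CE bl br bC sff_tensor_normal sff_tensor_fiber_P sff_tensor_fiber_nu
  e2 d2 EgE' DgD'.
rewrite /signed_sqnorm.
have de s : differentiable (e s) u.
  by apply: smooth_differentiable Au; exact: frame_smooth he _.
have dd s : differentiable (d s) u.
  by apply: smooth_differentiable Au; exact: frame_smooth hd _.
under eq_bigr => s _ do under eq_bigr => t _ do
  rewrite (sff_tensorial G oA sx Au (e s) (de t)).
under [X in _ + X]eq_bigr => s _ do under eq_bigr => t _ do
  rewrite (sff_nu_top (dd t) (dE s) (dE t)).
move: main; congr (_ <= _ + _).
  by apply: eq_bigr => s _; apply: eq_bigr => t _; rewrite !rowK !mxE.
by apply: eq_bigr => s _; apply: eq_bigr => t _; rewrite !mxE.
Qed.

End PRImmersion.

(** * From charts to manifolds *)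

(** The parallelism of P on constant vector fields is a pointwise identity
    between its derivative and the Christoffel symbols. *)
Lemma para_kaehler_parallel_endo (R : realType) (n : nat) (M : atlas R n)
    (g P : tensor2 M) (a : idx M) (y : 'rV[R]_n) :
  para_kaehler g P -> coords a y -> forall v w,
  w *m 'D_v (P a) y + christoffel_vec (g a) y v (w *m P a y)
  = christoffel_vec (g a) y v w *m P a y.
Proof.
move=> hM Oy v w; have aph := pk_aph hM.
have oO : open (coords a) :=
  @coords_open _ _ _ (aph_manifold aph) a.
have dP : differentiable (P a) y.
  by apply: (smooth_differentiable _ Oy); exact: endo_smooth (aph_endo aph) _.
have := pk_parallel hM oO (fun _ => id) (smooth_cst _ v) (smooth_cst _ w) Oy.
rewrite /nabla derive_cst add0r => <-.
congr (_ + _).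
have [_ ->] :=
  is_derive_mulmx (derivable_cst w y v) (diff_derivable (v := v) dP).
by rewrite derive_cst mul0mx add0r.
Qed.

Lemma overlap_loc (R : realType) (m n : nat) (M : atlas R m) (N : atlas R n)
    (phi : M -> N) (i : idx M) (a : idx N) u :
  (forall x, dom i x -> param i (chart i x) = x) ->
  overlap phi i a u -> coords a (loc phi i a u).
Proof.
by move=> K [y [yi ya] <-]; exists (phi y) => //; rewrite /loc K.
Qed.

Lemma overlap_prod_coords (R : realType) (b p n : nat) (B : atlas R b)
    (F : atlas R p) (N : atlas R n) (phi : prod_atlas B F -> N)
    (i : idx (prod_atlas B F)) (a : idx N) u :
  overlap phi i a u -> coords i.1 (lsubmx u) /\ coords i.2 (rsubmx u).
Proof.
case=> y [[y1 y2] _] <-; split.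
  by exists y.1 => //=; rewrite row_mxKl.
by exists y.2 => //=; rewrite row_mxKr.
Qed.

Theorem theorem4p1 (R : realType) (n b p : nat)
  (Mt : atlas R n) (gt P : tensor2 Mt)
  (Ntop : atlas R b) (gtop : tensor2 Ntop)
  (Nperp : atlas R p) (gperp : tensor2 Nperp)
  (f : Ntop -> R) (phi : prod_atlas Ntop Nperp -> Mt)
  (hMt : para_kaehler gt P)
  (hM : PR_warped_product gt P gtop gperp f phi)
  (hperp : space_like gperp)
  (hnormal : normal_parallel_PDperp gt P phi)
  (* a chart of M, a chart of the ambient manifold, an open set of coordinates
     and local orthonormal frames e of TM and d of D *)
  (i : idx (prod_atlas Ntop Nperp)) (a : idx Mt) (A : set 'rV[R]_(b + p))
  (e : 'I_(b + p) -> 'rV[R]_(b + p) -> 'rV[R]_(b + p))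
  (d : 'I_b -> 'rV[R]_(b + p) -> 'rV[R]_(b + p))
  (hA : open A) (hAi : A `<=` overlap phi i a)
  (he : orthonormal_frame (pullback (gt a) (loc phi i a)) A
          (fun _ => 1%:M) e)
  (hd : orthonormal_frame (pullback (gt a) (loc phi i a)) A
          (fun _ => first_factor R b p) d)
  (u : 'rV[R]_(b + p)) (hu : A u) :
  let G := gt a in
  let x := loc phi i a in
  let g := pullback G x in
  let grad_ln_f := gradient g (fun v => ln (f (param i v).1)) u in
  signed_sqnorm (g u) (G (x u)) e (sff G x) u
  <= 2 * p%:R * inner (g u) grad_ln_f grad_ln_f
     + signed_sqnorm (g u) (G (x u)) d (sff_nu G (P a) x) u.
Proof.
rewrite /=; set G := gt a; set x := loc phi i a.
have aph := pk_aph hMt; have [GS Gsym Gund _] := aph_metric aph.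
have uO := hAi _ hu; have [uB uF] := overlap_prod_coords uO.
have xO t : A t -> coords a (x t).
  move=> At; apply: overlap_loc (hAi _ At) => y /= [y1 y2].
  rewrite row_mxKl row_mxKr (chartK (prw_base hM)) //.
  rewrite (chartK (prw_fiber hM)) //.
  by case: y {y1 y2}.
have [phiS gi gnd] := prw_sub hM.
have sx : smooth_on A x by apply: (smooth_onS _ hAi); exact: phiS.2.
have f0 := prw_f_pos hM (param i.1 (lsubmx u)).
have dF : differentiable (f \o param i.1) (lsubmx u).
  exact: (smooth_differentiable (prw_f_smooth hM i.1)).
have /andP[inv _] := prw_invariant hM uO.
have /submxP[C CE] := inv.
have oO : open (coords a) :=
  @coords_open _ _ _ (aph_manifold aph) a.
have sP : smooth_on (coords a) (P a) by exact: endo_smooth (aph_endo aph) _.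
have sG : smooth_on (coords a) G by exact: GS.
have gu : pullback G x u \in unitmx by exact: gnd.
have np v (z : 'rV[R]_p) : (normal_connection G x (cst v)
    (fun t => push x (cst (row_mx 0 z)) t *m P a (x t)) u
    <= PDperp (P a) x u)%MS.
  apply: (hnormal i a A (cst v) (cst (row_mx 0 z))) => //;
    try exact: smooth_cst.
  move=> t _; apply/submxP; exists z.
  by rewrite /second_factor mul_mx_row mulmx1 mulmx0.
have main := chart_inequality hA oO xO sx sG (Gsym a) (Gund a) sP
  (fun y Oy => aph_square aph Oy) (fun y Oy => aph_compat aph Oy)
  (fun y Oy => para_kaehler_parallel_endo hMt Oy) hu
  (fun t At => prw_warped hM (hAi _ At)) dF f0 gu
  (metric_nondeg (prw_gB hM) uB) (Defs.metric_sym (prw_gF hM) uF) (hperp _ _ uF)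
  (fun t At => prw_anti_invariant hM (hAi _ At)) np CE he hd.
exact: main.
Qed.
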